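(* Let $G$ be an infinite finitely generated group and let $\sigma$ be an almost submultiplicative growth function with $\beta_G\preccurlyeq\sigma$. Then the locally convex inductive limit topology of the inductive system $\{\ell^1_{L,\sigma,R}(G)'\}_{R\ge0}$ of Banach space duals yields the strong topology on the topological dual of $\mathcal{A}_\sigma(G)$, i.e. $$\mathcal{A}_\sigma(G)'=\operatorname{ind\,lim}_{R\to\infty}\ell^1_{L,\sigma,R}(G)'\cong\operatorname{ind\,lim}_{R\to\infty}\ell^\infty_{L,\sigma,-R}(G)$$ as locally convex spaces, where $\mathcal{A}_\sigma(G)'$ carries the strong topology. Here the identification is that of vector spaces $\mathcal{A}_\sigma(G)'\cong\bigcup_{R\ge0}\ell^\infty_{L,\sigma,-R}(G)$ in which $b\in\ell^\infty_{L,\sigma,-R}(G)$ corresponds to the functional $a\mapsto\mathrm{tr}(ba)=\sum_{g\in G}b_g a_{g^{-1}}$.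
   Context: Fix a finite generating set $S=S^{-1}$ of $G$; the word length $L(g)\in\mathbb{N}_0$ is the minimal number of elements of $S$ needed to write $g$ as a product, $L(e)=0$. The volume growth is $\beta_G(n)=\#\{g\in G:L(g)\le n\}$. A growth function is a map $\sigma\colon\mathbb{N}_0\to[1,\infty)$ that is monotonically increasing ($\sigma(n)\le\sigma(n+1)$) and unbounded. It is almost submultiplicative if for every $\epsilon>0$ there is $c>0$ with $\sigma(n+m)\le c\,\sigma(n)^{1+\epsilon}\sigma(m)^{1+\epsilon}$ for all $n,m\in\mathbb{N}_0$. For maps $\sigma,\sigma'\colon\mathbb{N}_0\to[1,\infty)$ write $\sigma\preccurlyeq\sigma'$ if there are an integer $c\ge1$ and a real $k\ge1$ with $\sigma(n)\le c\,\sigma'(cn)^k$ for all $n\in\mathbb{N}_0$. $\mathbb{C}[[G]]$ is the space of all formal series $a=\sum_{g\in G}a_g\mathsf{e}_g$, $a_g\in\mathbb{C}$. For $R\ge0$: $\|a\|_{L,\sigma,R}=\sum_g|a_g|\sigma(L(g))^R$, $\ell^1_{L,\sigma,R}(G)=\{a\in\mathbb{C}[[G]]:\|a\|_{L,\sigma,R}<\infty\}$; $\|b\|_{\ell^\infty,L,\sigma,-R}=\sup_g|b_g|/\sigma(L(g))^R$, $\ell^\infty_{L,\sigma,-R}(G)=\{b\in\mathbb{C}[[G]]:\|b\|_{\ell^\infty,L,\sigma,-R}<\infty\}$; these are Banach spaces. $\mathcal{A}_\sigma(G)=\bigcap_{R\ge0}\ell^1_{L,\sigma,R}(G)$ with the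 topology of all norms $\|\cdot\|_{L,\sigma,R}$, $R\ge0$. For $R\ge R'\ge0$ one has continuous inclusions $\ell^\infty_{L,\sigma,-R'}(G)\subseteq\ell^\infty_{L,\sigma,-R}(G)$ and, by restriction of functionals, $\ell^1_{L,\sigma,R'}(G)'\to\ell^1_{L,\sigma,R}(G)'$; these maps define the inductive systems. The strong topology on the dual is that of uniform convergence on bounded subsets. *)

(* Defs.v *)
From HB Require Import structures.
From mathcomp Require Import all_boot all_order all_algebra finmap complex.
From mathcomp Require Import all_classical all_reals all_analysis.
From mathcomp Require summability.

Set Implicit Arguments.
Unset Strict Implicit.
Unset Printing Implicit Defensive.

Import Order.TTheory GRing.Theory Num.Theory.
Import numFieldNormedType.Exports.
Import Normc.

Local Open Scope classical_set_scope.
Local Open Scope ring_scope.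

(* mathcomp has the norm of [R[i]] valued in [R[i]]; [normc] is the modulus
   valued in [R]. *)
Record seminorm (R : realType) (E : lmodType R[i]) := Seminorm {
  sn :> E -> R;
  snD : forall x y, sn (x + y) <= sn x + sn y;
  snZ : forall c x, sn (c *: x) = normc c * sn x }.

Lemma normc_realE (R : realType) (z : R[i]) : `|z| = (normc z)%:C%C.
Proof. by case: z => a b; rewrite normc_def. Qed.

Lemma normc_ge0 (R : realType) (z : R[i]) : 0 <= normc z.
Proof. by case: z => a b; exact: sqrtr_ge0. Qed.

Lemma normc_real (R : realType) (r : R) : normc r%:C%C = `|r|.
Proof. by rewrite /= expr0n addr0 sqrtr_sqr. Qed.

Section seminorm_theory.
Variables (R : realType) (E : lmodType R[i]) (p : seminorm E).

Lemma sn0 : p 0 = 0.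
Proof. by rewrite -(scale0r 0) snZ normc0 mul0r. Qed.

Lemma snN x : p (- x) = p x.
Proof. by rewrite -scaleN1r snZ normcN normc1 mul1r. Qed.

Lemma sn_ge0 x : 0 <= p x.
Proof.
have := snD p x (- x); rewrite subrr sn0 snN -mulr2n.
by rewrite pmulrn_lge0.
Qed.

End seminorm_theory.

(* [E] with the locally convex topology defined by the seminorms [p i]. *)
Definition lcspace (R : realType) (E : lmodType R[i]) (I : Type)
  (p : I -> seminorm E) : Type := E.

Local Open Scope convex_scope.

Section lcspace_tvs.
Variables (R : realType) (E : lmodType R[i]) (I : Type) (p : I -> seminorm E).
Local Notation T := (lcspace p).
Implicit Types (F : seq I) (e : R) (x y z : E).

HB.instance Definition _ := GRing.Lmodule.on T.

Definition sn_ball F e x : set E := [set y | all (fun i => p i (y - x) < e) F].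

Definition sn_nbhs x : set_system E :=
  [set U | exists F e, 0 < e /\ sn_ball F e x `<=` U].

HB.instance Definition _ := hasNbhs.Build T sn_nbhs.

Lemma sn_ball_center F e x : 0 < e -> sn_ball F e x x.
Proof.
by move=> e0; rewrite /sn_ball/=; elim: F => // i F /= ->; rewrite subrr sn0 e0.
Qed.

Lemma sn_ball_le F d e x : d <= e -> sn_ball F d x `<=` sn_ball F e x.
Proof.
by move=> de y; rewrite /sn_ball/=; apply: sub_all => i /lt_le_trans; exact.
Qed.

Lemma sn_ball_cat F F' e x :
  sn_ball (F ++ F') e x = sn_ball F e x `&` sn_ball F' e x.
Proof.
apply/seteqP; split => y; rewrite /sn_ball/= all_cat; first by move/andP.
by move=> [? ?]; apply/andP.
Qed.

Lemma sn_ball_open F e x y : sn_ball F e x y ->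
  exists2 d, 0 < d & sn_ball F d y `<=` sn_ball F e x.
Proof.
elim: F => [|i F IH]; first by exists 1.
rewrite /sn_ball/= => /andP[yi /IH[d d0 dF]].
have yi0 : 0 < e - p i (y - x) by rewrite subr_gt0.
exists (Num.min d (e - p i (y - x))); first by rewrite lt_min d0.
move=> z /= /andP[zi zF]; apply/andP; split.
  have -> : z - x = (z - y) + (y - x) by rewrite addrA subrK.
  apply: le_lt_trans (snD _ _ _) _.
  by rewrite -ltrBrDr (lt_le_trans zi)// ge_min lexx orbT.
by apply/dF/(sn_ball_le _ zF); rewrite ge_min lexx.
Qed.

Lemma sn_nbhs_filter (x : T) : ProperFilter (nbhs x).
Proof.
split.
  by move=> [F [e [e0 /(_ _ (sn_ball_center F x e0))]]].
split.
- by exists [::], 1.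
- move=> U V [F [e [e0 FU]]] [F' [e' [e'0 FV]]].
  exists (F ++ F'), (Num.min e e'); split; first by rewrite lt_min e0.
  rewrite sn_ball_cat => y [yF yF']; split.
    by apply/FU/(sn_ball_le _ yF); rewrite ge_min lexx.
  by apply/FV/(sn_ball_le _ yF'); rewrite ge_min lexx orbT.
- by move=> U V UV [F [e [e0 FU]]]; exists F, e; split => // y /FU/UV.
Qed.

Lemma sn_nbhs_singleton (x : T) (A : set T) : nbhs x A -> A x.
Proof. by move=> [F [e [e0]]]; apply; exact: sn_ball_center. Qed.

Lemma sn_nbhs_nbhs (x : T) (A : set T) : nbhs x A -> nbhs x (nbhs^~ A).
Proof.
move=> [F [e [e0 FA]]]; exists F, e; split => // y /sn_ball_open[d d0 dF].
by exists F, d; split => // z /dF/FA.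
Qed.

HB.instance Definition _ := Nbhs_isNbhsTopological.Build T
  sn_nbhs_filter sn_nbhs_singleton sn_nbhs_nbhs.

Lemma lcspace_add_continuous : continuous (fun x : T * T => x.1 + x.2).
Proof.
move=> [x y] U [F [e [e0 FU]]] /=.
exists (sn_ball F (e / 2) x, sn_ball F (e / 2) y).
  by split; exists F, (e / 2); split => //; rewrite divr_gt0.
move=> [x' y'] /= [xF yF]; apply: FU.
move: xF yF; rewrite /sn_ball/=; elim: F => //= i F IH.
move=> /andP[xi xF] /andP[yi yF]; rewrite IH// andbT.
rewrite opprD addrACA (splitr e).
by apply: le_lt_trans (snD _ _ _) _; exact: ltrD.
Qed.

Lemma sn_seq_bound F x : exists2 M, 0 < M & all (fun i => p i x <= M) F.
Proof.
elim: F => [|i F [M M0 FM]]; first by exists 1.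
exists (Num.max M (p i x)); first by rewrite lt_max M0.
rewrite /= le_max lexx orbT/=; apply: sub_all FM => j jM.
by rewrite le_max jM.
Qed.

Lemma lcspace_scale_continuous : continuous (fun z : R[i]^o * T => z.1 *: z.2).
Proof.
move=> [c x] U [F [e [e0 FU]]] /=.
have [M M0 FM] := sn_seq_bound F x.
pose d := Num.min 1 (e / 2 / M).
have d0 : 0 < d by rewrite lt_min ltr01 !divr_gt0.
have c1 : 0 < normc c + 1 by rewrite ltr_wpDl// normc_ge0.
pose e' := e / 2 / (normc c + 1).
have e'0 : 0 < e' by rewrite !divr_gt0.
exists ([set c' | normc (c - c') < d], sn_ball F e' x).
  split; last by exists F, e'; split.
  exists d%:C%C => /=; first by rewrite ltcR.
  by move=> z /=; rewrite normc_realE ltcR.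
move=> [c' x'] /= [cc' xF]; apply: FU.
move: FM xF; rewrite /sn_ball/=; elim: F => //= i F IH /andP[iM FM] /andP[xi xF].
rewrite IH// andbT.
have -> : c' *: x' - c *: x = c' *: (x' - x) - (c - c') *: x.
  by rewrite scalerBr scalerBl opprB addrA subrK.
apply: le_lt_trans (snD _ _ _) _; rewrite snN !snZ (splitr e).
apply: ltr_leD.
  have [->|x0] := eqVneq (p i (x' - x)) 0; first by rewrite mulr0 divr_gt0.
  have c'le : normc c' <= normc c + 1.
    have -> : c' = c - (c - c') by rewrite subKr.
    apply: le_trans (le_normcD _ _) _; rewrite normcN lerD2l.
    by apply: ltW; rewrite (lt_le_trans cc')// ge_min lexx.
  apply: le_lt_trans (ler_wpM2r (sn_ge0 _ _) c'le) _.
  by rewrite mulrC -ltr_pdivlMr.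
apply: le_trans (ler_wpM2l (normc_ge0 _) iM) _.
rewrite -ler_pdivlMr//; apply: ltW; rewrite (lt_le_trans cc')//.
by rewrite ge_min lexx orbT.
Qed.

Lemma lcspace_locally_convex : exists2 B : set_system T,
  (forall b, b \in B -> convex_set b) & basis B.
Proof.
exists [set b | exists F e x, 0 < e /\ b = sn_ball F e x].
  move=> b; rewrite inE => -[F [e [x [e0 ->]]]].
  apply/convex_setW => y z; rewrite !inE => yF zF l l0 l1; rewrite inE.
  move: yF zF; rewrite /sn_ball/=; elim: F => //= i F IH.
  move=> /andP[yi yF] /andP[zi zF]; rewrite IH// andbT.
  have lE : l%:num = (normc l%:num)%:C%C.
    by rewrite -normc_realE ger0_norm// ltW.
  move: l0 l1; rewrite lE -[1]/(1%:C%C) !ltcR => l0 l1.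
  have {IH yF zF}-> : (y <| l |> z) - x =
     l%:num *: (y - x) + (1 - l%:num) *: (z - x) :> E.
    by rewrite !scalerBr addrACA -opprD -scalerDl [_ + (1 - _)]addrC subrK scale1r.
  apply: le_lt_trans (snD _ _ _) _; rewrite !snZ.
  have -> : normc (1 - l%:num) = 1 - normc l%:num.
    have -> : 1 - l%:num = (1 - normc l%:num)%:C%C by rewrite rmorphB/= -lE.
    by rewrite normc_real ger0_norm// subr_ge0 ltW.
  set t := normc _ in l0 l1 *.
  have -> : e = t * e + (1 - t) * e by rewrite -mulrDl addrC subrK mul1r.
  by rewrite ltrD// ltr_pM2l// subr_gt0.
split.
  move=> b [F [e [x [e0 ->]]]]; rewrite openE => y /= /sn_ball_open[d d0 dF].
  by exists F, d; split.
move=> x U [F [e [e0 FU]]]; exists (sn_ball F e x) => //; split.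
  by exists F, e, x.
exact: sn_ball_center.
Qed.

(* This factory only yields the uniform structure; the three instances after it
   complete the [tvsType]. *)
HB.instance Definition _ := PreTopologicalLmod_isTvs.Build R[i] T
  lcspace_add_continuous lcspace_scale_continuous lcspace_locally_convex.
HB.instance Definition _ := PreTopologicalNmodule_isTopologicalNmodule.Build T
  lcspace_add_continuous.
HB.instance Definition _ := TopologicalNmodule_isTopologicalLmodule.Build R[i] T
  lcspace_scale_continuous.
HB.instance Definition _ := Uniform_isTvs.Build R[i] T lcspace_locally_convex.

End lcspace_tvs.

Lemma lcspace_continuous (R : realType) (E F : lmodType R[i]) (I J : Type)
    (p : I -> seminorm E) (q : J -> seminorm F)
    (f : {linear lcspace p -> lcspace q}) :
  (forall j, exists i, forall x : E, q j (f x) <= p i x) -> continuous f.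
Proof.
move=> /boolp.choice[h hle] x U [s [e [e0 sU]]].
exists (map h s), e; split => // y.
rewrite /sn_ball/= all_map => /= yP; apply: sU; rewrite /sn_ball/=.
apply: sub_all yP => j; apply: le_lt_trans.
by have := hle j (y - x); rewrite raddfB.
Qed.

Section submod.
Variables (K : pzRingType) (V : lmodType K) (S : submodClosed V).

Definition submod_of : Type := {x : V | x \in S}.

HB.instance Definition _ := [isSub of submod_of for @sval V _].
HB.instance Definition _ := [Choice of submod_of by <:].
HB.instance Definition _ := [SubChoice_isSubLmodule of submod_of by <:].

End submod.

Section dual.
Variables (K : numFieldType) (E : tvsType K).

Definition dual_pred : {pred E -> K^o} :=
  [pred f | `[< linear f /\ continuous f >] ].

Lemma dual_pred_submod : submod_closed dual_pred.
Proof.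
split.
  apply/asboolP; split; first by move=> a x y; rewrite /= scaler0 addr0.
  by move=> x; exact: cvg_cst.
move=> a f g /asboolP[lf cf] /asboolP[lg cg]; apply/asboolP; split.
  move=> b x y; rewrite /= !fctE lf lg !scalerDr !scalerA mulrC.
  by rewrite -!addrA; congr +%R; rewrite addrCA.
move=> x; apply: (@cvgD K K^o); last exact: cg.
by apply: (@cvgZl_tmp K K^o); exact: cf.
Qed.

HB.instance Definition _ := GRing.isSubmodClosed.Build K (E -> K^o) dual_pred
  (GRing.submod_closed_semi dual_pred_submod).

Definition dual := submod_of dual_pred.
HB.instance Definition _ := GRing.Lmodule.on dual.

Definition dual_fun (phi : dual) : E -> K^o := val phi.

Lemma dual_fun_linear phi : linear (dual_fun phi).
Proof. by have /asboolP[] := valP phi. Qed.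

HB.instance Definition _ phi :=
  GRing.isLinear.Build K E K^o *:%R (dual_fun phi) (dual_fun_linear phi).

Lemma dual_fun_continuous phi : continuous (dual_fun phi).
Proof. by have /asboolP[] := valP phi. Qed.

End dual.
Coercion dual_fun : dual >-> Funclass.

Lemma dual_eq (K : numFieldType) (E : tvsType K) (phi psi : dual E) :
  (forall a, phi a = psi a) -> phi = psi.
Proof. by move=> e; apply/val_inj/funext. Qed.

Section transpose.
Variables (K : numFieldType) (E F : tvsType K) (f : {linear E -> F}).
Hypothesis fc : continuous f.

Lemma transpose_subproof (phi : dual F) : (phi \o f : E -> K^o) \in @dual_pred K E.
Proof.
apply/asboolP; split; first by move=> a x y; rewrite /= !linearP.
by move=> x; apply: continuous_comp; [exact: fc|exact: dual_fun_continuous].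
Qed.

Definition transpose (phi : dual F) : dual E :=
  exist (fun g => g \in @dual_pred K E) _ (transpose_subproof phi).

Lemma transpose_linear : linear transpose.
Proof. by move=> a phi psi; apply/val_inj. Qed.

End transpose.

Section sup_seminorm.
Variables (R : realType) (E : tvsType R[i]) (X : set E).
Local Notation abs_on phi := [set normc (dual_fun phi a) | a in X].
Hypothesis X_bounded : forall phi : dual E, has_ubound (abs_on phi).

Definition sup_on (phi : dual E) : R := sup (abs_on phi).

Lemma sup_on_ge (phi : dual E) a : X a -> normc (phi a) <= sup_on phi.
Proof. by move=> Xa; apply: ub_le_sup; [exact: X_bounded|exists a]. Qed.

Lemma sup_on_le (phi : dual E) M : 0 <= M -> (forall a, X a -> normc (phi a) <= M) ->
  sup_on phi <= M.
Proof.
move=> M0 XM; have [[a Xa]|X0] := pselect (X !=set0).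
  by apply: ge_sup; [exists (normc (phi a)), a|move=> _ [b Xb <-]; exact: XM].
suff -> : sup_on phi = 0 by [].
rewrite /sup_on (_ : abs_on phi = set0) ?sup0//.
by apply/seteqP; split => // y [a Xa _]; apply: X0; exists a.
Qed.

Lemma sup_on_ge0 phi : 0 <= sup_on phi.
Proof.
have [[a Xa]|X0] := pselect (X !=set0).
  exact: le_trans (normc_ge0 _) (sup_on_ge phi Xa).
rewrite /sup_on (_ : abs_on phi = set0) ?sup0//.
by apply/seteqP; split => // y [a Xa _]; apply: X0; exists a.
Qed.

Lemma sup_onD phi psi : sup_on (phi + psi) <= sup_on phi + sup_on psi.
Proof.
apply: sup_on_le => [|a Xa]; first by rewrite addr_ge0 ?sup_on_ge0.
exact: le_trans (le_normcD _ _) (lerD (sup_on_ge _ Xa) (sup_on_ge _ Xa)).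
Qed.

Lemma sup_onZ c phi : sup_on (c *: phi) = normc c * sup_on phi.
Proof.
have le b (psi : dual E) : sup_on (b *: psi) <= normc b * sup_on psi.
  apply: sup_on_le => [|a Xa]; first by rewrite mulr_ge0 ?normc_ge0 ?sup_on_ge0.
  rewrite [X in normc X](_ : _ = b * psi a)// normcM.
  by rewrite ler_wpM2l ?normc_ge0// sup_on_ge.
apply/eqP; rewrite eq_le le/=.
have [->|c0] := eqVneq c 0; first by rewrite normc0 mul0r sup_on_ge0.
have nc0 : 0 < normc c.
  by rewrite lt_neqAle normc_ge0 andbT eq_sym; apply: contra_neq c0 => /eq0_normc.
rewrite -ler_pdivlMl// -normcV.
by have := le c^-1 (c *: phi); rewrite scalerA mulVf// scale1r.
Qed.

Definition sup_seminorm : seminorm (dual E) := Seminorm sup_onD sup_onZ.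

End sup_seminorm.

(* [B] is absorbed by every neighbourhood of 0. *)
Definition tvs_bounded (R : realType) (E : tvsType R[i]) (B : set E) :=
  forall U : set E, nbhs 0 U -> exists2 s : R, 0 < s &
    forall c : R[i], s <= normc c -> B `<=` [set c *: u | u in U].

Section strong_dual.
Variables (R : realType) (E : tvsType R[i]).

Lemma dual_nbhs0 (phi : dual E) : nbhs 0 [set x | normc (phi x) < 1].
Proof.
apply: (@dual_fun_continuous _ _ phi 0 [set z | normc z < 1]).
rewrite linear0.
exists 1 => //= z /=; rewrite sub0r normrN normc_realE -[1]/(1%:C%C).
by rewrite ltcR.
Qed.

Lemma tvs_bounded_dual (B : set E) : tvs_bounded B ->
  forall phi : dual E, has_ubound [set normc (phi a) | a in B].
Proof.
move=> Bb phi; have [s s0 sB] := Bb _ (dual_nbhs0 phi).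
exists s => _ [a Ba <-].
have [|u /= u1 <-] := sB s%:C%C _ a Ba; first by rewrite normc_real gtr0_norm.
rewrite linearZ normcM normc_real gtr0_norm// -[leRHS]mulr1.
by rewrite ler_wpM2l// ltW.
Qed.

Definition strong_seminorm (B : {B : set E | tvs_bounded B}) :
  seminorm (dual E) := sup_seminorm (tvs_bounded_dual (projT2 B)).

(* The topology of uniform convergence on the bounded subsets of [E]. *)
Definition strong_dual : tvsType R[i] := lcspace strong_seminorm.

End strong_dual.

Section normed_dual.
Variables (R : realType) (E : lmodType R[i]) (N : seminorm E).

Definition seminormed : tvsType R[i] := lcspace (fun _ : unit => N).

Lemma unit_ball_dual (phi : dual seminormed) :
  has_ubound [set normc (phi a) | a in [set a : seminormed | N a <= 1]].
Proof.
have [F [e [e0 FU]]] := dual_nbhs0 phi.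
exists (e / 2)^-1 => _ [a /= Na <-].
have e20 : 0 < e / 2 by rewrite divr_gt0.
have : normc (phi ((e / 2)%:C%C *: a)) < 1.
  apply: FU; rewrite /sn_ball/=; elim: F => //= _ F ->; rewrite andbT subr0.
  rewrite snZ normc_real gtr0_norm// (@le_lt_trans _ _ (e / 2))//.
    by rewrite -[leRHS]mulr1 ler_wpM2l// ltW.
  by rewrite ltr_pdivrMr// ltr_pMr// ltr1n.
rewrite linearZ normcM normc_real gtr0_norm// => /ltW.
by rewrite -ler_pdivlMl// mulr1.
Qed.

Definition dual_norm : seminorm (dual seminormed) := sup_seminorm unit_ball_dual.

Definition normed_dual : tvsType R[i] := lcspace (fun _ : unit => dual_norm).

End normed_dual.

Section normed_dual_map.
Variables (R : realType) (E F : lmodType R[i]) (N : seminorm E) (M : seminorm F).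
Variable f : {linear seminormed N -> seminormed M}.
Hypothesis fle : forall x, M (f x) <= N x.

Lemma contraction_continuous : continuous f.
Proof. by apply: lcspace_continuous => j; exists tt. Qed.

Definition contraction_transpose (phi : normed_dual M) : normed_dual N :=
  transpose contraction_continuous phi.

HB.instance Definition _ := GRing.isLinear.Build R[i] (normed_dual M)
  (normed_dual N) *:%R contraction_transpose
  (@transpose_linear _ _ _ _ contraction_continuous).

Lemma contraction_transpose_continuous : continuous contraction_transpose.
Proof.
apply: lcspace_continuous => j; exists tt => phi /=.
apply: sup_on_le; first exact: sup_on_ge0 (@unit_ball_dual _ _ _) _.
move=> a Na; apply: (@sup_on_ge _ _ _ (@unit_ball_dual _ _ M) phi (f a)) => /=.
exact: le_trans (fle _) Na.
Qed.

End normed_dual_map.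

Record inductive_system (K : numDomainType) d (I : porderType d) :=
  InductiveSystem {
    step :> I -> tvsType K;
    transition : forall i j, (i <= j)%O -> {linear step i -> step j};
    transition_continuous : forall i j (ij : (i <= j)%O),
      continuous (transition ij);
    transition_id : forall i (ii : (i <= i)%O) x, transition ii x = x;
    transition_comp : forall i j k (ij : (i <= j)%O) (jk : (j <= k)%O)
      (ik : (i <= k)%O) x, transition jk (transition ij x) = transition ik x }.

(* [E] with the maps [in_ i] is the algebraic inductive limit of the system,
   and its topology is the finest locally convex one for which all [in_ i] are
   continuous: a linear bijection [f : E -> F] presents [F] as [E] endowed with
   another locally convex topology.  The library's [tvsType] already requires
   local convexity. *)
Record is_lc_inductive_limit (K : numDomainType) d (I : porderType d)
    (X : inductive_system K I) (E : tvsType K)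
    (in_ : forall i, {linear X i -> E}) : Prop := IsLcInductiveLimit {
  lim_compatible : forall i j (ij : (i <= j)%O) x,
    in_ j (transition X ij x) = in_ i x;
  lim_surjective : forall y, exists i x, in_ i x = y;
  lim_kernel : forall i x, in_ i x = 0 ->
    exists j (ij : (i <= j)%O), transition X ij x = 0;
  lim_continuous : forall i, continuous (in_ i);
  lim_finest : forall (F : tvsType K) (f : {linear E -> F}), bijective f ->
    (forall i, continuous (f \o in_ i)) -> continuous f }.

Section word_length.
Variables (G : groupType) (S : {fset G}).

Definition is_word (g : G) (s : seq G) :=
  {subset s <= S} /\ (\prod_(x <- s) x)%g = g.

Definition generates := forall g, exists s, is_word g s.

(* Only meaningful when [S] generates [G]: [get] returns 0 on an empty set. *)
Definition word_length (g : G) : nat :=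
  get [set n : nat | (exists2 s, is_word g s & size s = n) /\
                     forall s, is_word g s -> (n <= size s)%N].

(* The ball is a finite set as soon as [S] generates [G]; [fset_set] would send
   an infinite set to the empty one. *)
Definition volume_growth (n : nat) : nat :=
  #|` fset_set [set g : G | (word_length g <= n)%N] |.

End word_length.

Record growth_function (R : realType) := GrowthFunction {
  gf :> nat -> R;
  gf_ge1 : forall n, 1 <= gf n;
  gf_le : forall n, gf n <= gf n.+1;
  gf_unbounded : forall M, exists n, M < gf n }.

Definition almost_submultiplicative (R : realType) (sigma : nat -> R) :=
  forall eps : R, 0 < eps -> exists2 c : R, 0 < c &
    forall n m, sigma (n + m)%N <= c * sigma n `^ (1 + eps) * sigma m `^ (1 + eps).

Definition growth_le (R : realType) (sigma sigma' : nat -> R) :=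
  exists (c : nat) (k : R), [/\ (1 <= c)%N, 1 <= k &
    forall n, sigma n <= c%:R * sigma' (c * n)%N `^ k].

Lemma esum_scale (R : realType) (T : choiceType) (k : R) (u : T -> R) :
  0 <= k -> (forall x, 0 <= u x) ->
  (\esum_(x in [set: T]) (k * u x)%:E = k%:E * \esum_(x in [set: T]) (u x)%:E)%E.
Proof.
have le (c : R) (v : T -> R) : 0 <= c -> (forall x, 0 <= v x) ->
    (\esum_(x in [set: T]) (c * v x)%:E <= c%:E * \esum_(x in [set: T]) (v x)%:E)%E.
  move=> c0 v0; apply: ge_ereal_sup => _ [F [finF _] <-].
  under eq_fsbigr do rewrite EFinM.
  rewrite -ge0_mule_fsumr; last by move=> x; rewrite lee_fin.
  rewrite lee_wpmul2l ?lee_fin//; apply: ereal_sup_ubound.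
  by exists F.
move=> k0 u0; apply/eqP; rewrite eq_le le//=.
have [->|kn0] := eqVneq k 0; first by rewrite mul0e esum_ge0// => x _; rewrite mul0r.
have kp : 0 < k by rewrite lt_neqAle eq_sym kn0.
have := le k^-1 (fun x => k * u x); under eq_esum do rewrite mulKf//.
move=> /(_ _ _)/(lee_wpmul2l (x := k%:E)).
rewrite muleA -EFinM divff// mul1e; apply; rewrite ?lee_fin ?invr_ge0//.
by move=> x; rewrite mulr_ge0.
Qed.

Section weighted_spaces.
Variables (R : realType) (G : groupType) (S : {fset G}).
Variable sigma : growth_function R.
Implicit Types (a b : G -> R[i]^o) (r : R).

Definition weight r (g : G) : R := sigma (word_length S g) `^ r.

Lemma weight_gt0 r g : 0 < weight r g.
Proof. by rewrite powR_gt0// (lt_le_trans ltr01)// gf_ge1. Qed.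

Lemma weight_ge0 r g : 0 <= weight r g.
Proof. exact/ltW/weight_gt0. Qed.

Lemma weight_le r s g : r <= s -> weight r g <= weight s g.
Proof. by apply: ler_powR; exact: gf_ge1. Qed.

Definition ell1_norm r a : \bar R :=
  \esum_(g in [set: G]) (normc (a g) * weight r g)%:E.

Lemma ell1_norm_ge0 r a : (0 <= ell1_norm r a)%E.
Proof.
by apply: esum_ge0 => g _; rewrite lee_fin mulr_ge0 ?normc_ge0 ?weight_ge0.
Qed.

Lemma ell1_normD r a b : (ell1_norm r (a + b)%R <= ell1_norm r a + ell1_norm r b)%E.
Proof.
rewrite /ell1_norm -esumD; try by move=> g _; rewrite lee_fin mulr_ge0 ?normc_ge0 ?weight_ge0.
apply: le_esum => g _; rewrite -EFinD lee_fin -mulrDl.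
by rewrite ler_wpM2r ?weight_ge0// le_normcD.
Qed.

Lemma ell1_normZ r c a : ell1_norm r (c *: a) = ((normc c)%:E * ell1_norm r a)%E.
Proof.
rewrite -esum_scale ?normc_ge0//; last first.
  by move=> g; rewrite mulr_ge0 ?normc_ge0 ?weight_ge0.
apply: eq_esum => g _; congr EFin; rewrite mulrA.
by rewrite [X in normc X](_ : _ = c * a g)// normcM.
Qed.

Lemma ell1_norm_le r s a : r <= s -> (ell1_norm r a <= ell1_norm s a)%E.
Proof.
move=> rs; apply: le_esum => g _; rewrite lee_fin.
by rewrite ler_wpM2l ?normc_ge0// weight_le.
Qed.

Lemma ell1_norm0 r : ell1_norm r 0 = 0%E.
Proof. by rewrite -[in LHS](scale0r (0 : G -> R[i]^o)) ell1_normZ normc0 mul0e. Qed.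

Lemma ell1_norm_lty r c a b : (ell1_norm r a < +oo)%E -> (ell1_norm r b < +oo)%E ->
  (ell1_norm r (c *: a + b)%R < +oo)%E.
Proof.
move=> ra rb; apply: le_lt_trans (ell1_normD _ _ _) _.
by rewrite ell1_normZ lte_add_pinfty// lte_mul_pinfty// lee_fin normc_ge0.
Qed.

Lemma ell1_norm_fin r a : (ell1_norm r a < +oo)%E -> ell1_norm r a \is a fin_num.
Proof. by move=> ra; rewrite ge0_fin_numE// ell1_norm_ge0. Qed.

Definition ell1_pred r : {pred G -> R[i]^o} :=
  [pred a | `[< (ell1_norm r a < +oo)%E >]].

Lemma ell1_pred_submod r : submod_closed (ell1_pred r).
Proof.
split; first by apply/asboolP; rewrite ell1_norm0.
by move=> c a b /asboolP ra /asboolP rb; apply/asboolP/ell1_norm_lty.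
Qed.

HB.instance Definition _ r := GRing.isSubmodClosed.Build R[i] (G -> R[i]^o)
  (ell1_pred r) (GRing.submod_closed_semi (ell1_pred_submod r)).

Definition ell1_carrier r := submod_of (ell1_pred r).
HB.instance Definition _ r := GRing.Lmodule.on (ell1_carrier r).

Lemma ell1_carrier_lty r (a : ell1_carrier r) : (ell1_norm r (val a) < +oo)%E.
Proof. by have /asboolP := valP a. Qed.

Definition fine_ell1_norm r (a : ell1_carrier r) : R := fine (ell1_norm r (val a)).

Lemma fine_ell1_normD r (a b : ell1_carrier r) :
  fine_ell1_norm (a + b) <= fine_ell1_norm a + fine_ell1_norm b.
Proof.
rewrite -fineD ?ell1_norm_fin ?ell1_carrier_lty//.
rewrite fine_le ?fin_numD ?ell1_norm_fin ?ell1_carrier_lty//.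
exact: ell1_normD.
Qed.

Lemma fine_ell1_normZ r c (a : ell1_carrier r) :
  fine_ell1_norm (c *: a) = normc c * fine_ell1_norm a.
Proof.
rewrite /fine_ell1_norm [val _](_ : _ = c *: val a)// ell1_normZ.
by rewrite fineM// ell1_norm_fin ?ell1_carrier_lty.
Qed.

Definition ell1_seminorm r : seminorm (ell1_carrier r) :=
  Seminorm (@fine_ell1_normD r) (@fine_ell1_normZ r).

Definition ell1 r : tvsType R[i] := seminormed (ell1_seminorm r).

Definition ell1_dual r : tvsType R[i] := normed_dual (ell1_seminorm r).

Definition alg_pred : {pred G -> R[i]^o} :=
  [pred a | `[< forall r, 0 <= r -> (ell1_norm r a < +oo)%E >]].

Lemma alg_pred_submod : submod_closed alg_pred.
Proof.
split; first by apply/asboolP => r _; rewrite ell1_norm0.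
move=> c a b /asboolP ra /asboolP rb; apply/asboolP => r r0.
by apply: ell1_norm_lty; [exact: ra|exact: rb].
Qed.

HB.instance Definition _ := GRing.isSubmodClosed.Build R[i] (G -> R[i]^o)
  alg_pred (GRing.submod_closed_semi alg_pred_submod).

Definition alg_carrier := submod_of alg_pred.
HB.instance Definition _ := GRing.Lmodule.on alg_carrier.

Lemma alg_carrier_lty (r : {nonneg R}) (a : alg_carrier) :
  (ell1_norm r%:num (val a) < +oo)%E.
Proof. by have /asboolP := valP a; apply. Qed.

Lemma alg_to_ell1_subproof (r : {nonneg R}) (a : alg_carrier) :
  val a \in ell1_pred r%:num.
Proof. exact/asboolP/alg_carrier_lty. Qed.

Definition alg_to_ell1 (r : {nonneg R}) (a : alg_carrier) : ell1_carrier r%:num :=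
  exist (fun a => a \in ell1_pred r%:num) _ (alg_to_ell1_subproof r a).

Lemma alg_to_ell1_linear (r : {nonneg R}) : linear (alg_to_ell1 r).
Proof. by move=> c a b; apply/val_inj. Qed.

HB.instance Definition _ (r : {nonneg R}) := GRing.isLinear.Build R[i] alg_carrier
  (ell1_carrier r%:num) *:%R (alg_to_ell1 r) (@alg_to_ell1_linear r).

Definition alg_norm (r : {nonneg R}) (a : alg_carrier) : R :=
  fine (ell1_norm r%:num (val a)).

Lemma alg_normD (r : {nonneg R}) (a b : alg_carrier) : alg_norm r (a + b) <= alg_norm r a + alg_norm r b.
Proof.
by have := snD (ell1_seminorm r%:num) (alg_to_ell1 r a) (alg_to_ell1 r b).
Qed.

Lemma alg_normZ (r : {nonneg R}) c (a : alg_carrier) : alg_norm r (c *: a) = normc c * alg_norm r a.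
Proof. by have := snZ (ell1_seminorm r%:num) c (alg_to_ell1 r a). Qed.

Definition alg_seminorm (r : {nonneg R}) : seminorm alg_carrier :=
  Seminorm (@alg_normD r) (@alg_normZ r).

(* The space written A_sigma(G), and its strong dual. *)
Definition alg : tvsType R[i] := lcspace alg_seminorm.

Definition alg_dual : tvsType R[i] := strong_dual alg.

HB.instance Definition _ (r : {nonneg R}) := GRing.isLinear.Build R[i] alg
  (ell1 r%:num) *:%R (alg_to_ell1 r) (@alg_to_ell1_linear r).

Lemma alg_to_ell1_continuous (r : {nonneg R}) : continuous (alg_to_ell1 r : alg -> ell1 r%:num).
Proof. by apply: lcspace_continuous => -[]; exists r. Qed.

Definition ell1_dual_to_alg_dual (r : {nonneg R}) (phi : ell1_dual r%:num) :
  alg_dual := transpose (@alg_to_ell1_continuous r) phi.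

HB.instance Definition _ (r : {nonneg R}) := GRing.isLinear.Build R[i] (ell1_dual r%:num)
  alg_dual *:%R (@ell1_dual_to_alg_dual r)
  (@transpose_linear _ _ _ _ (@alg_to_ell1_continuous r)).

Section ell1_inclusion.
Variables (r s : R) (rs : r <= s).

Lemma ell1_incl_subproof (a : ell1_carrier s) : val a \in ell1_pred r.
Proof.
apply/asboolP; apply: le_lt_trans (ell1_carrier_lty a); exact: ell1_norm_le.
Qed.

Definition ell1_incl (a : ell1 s) : ell1 r :=
  exist (fun a => a \in ell1_pred r) _ (ell1_incl_subproof a).

Lemma ell1_incl_linear : linear ell1_incl.
Proof. by move=> c a b; apply/val_inj. Qed.

HB.instance Definition _ := GRing.isLinear.Build R[i] (ell1 s) (ell1 r) *:%R
  ell1_incl ell1_incl_linear.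

Lemma ell1_incl_le (a : ell1 s) :
  ell1_seminorm r (ell1_incl a) <= ell1_seminorm s a.
Proof.
by apply: fine_le; rewrite ?ell1_norm_fin ?ell1_carrier_lty ?ell1_norm_le.
Qed.

Definition ell1_dual_restr : {linear ell1_dual r -> ell1_dual s} :=
  contraction_transpose ell1_incl_le.

Lemma ell1_dual_restr_continuous : continuous ell1_dual_restr.
Proof. exact: contraction_transpose_continuous. Qed.

Lemma ell1_dual_restrE (phi : ell1_dual r) (a : ell1 s) :
  dual_fun (ell1_dual_restr phi) a = dual_fun phi (ell1_incl a).
Proof. by []. Qed.

End ell1_inclusion.

Lemma ell1_dual_restr_id r (rr : r <= r) phi : ell1_dual_restr rr phi = phi.
Proof.
apply: dual_eq => a; rewrite ell1_dual_restrE; congr (dual_fun phi _).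
exact/val_inj.
Qed.

Lemma ell1_dual_restr_comp r s t (rs : r <= s) (st : s <= t) (rt : r <= t) phi :
  ell1_dual_restr st (ell1_dual_restr rs phi) = ell1_dual_restr rt phi.
Proof.
apply: dual_eq => a; rewrite !ell1_dual_restrE; congr (dual_fun phi _).
exact/val_inj.
Qed.

Definition ell1_dual_system : inductive_system R[i] {nonneg R} :=
  @InductiveSystem _ _ {nonneg R} (fun r : {nonneg R} => ell1_dual r%:num)
    (fun (r s : {nonneg R}) rs => @ell1_dual_restr r%:num s%:num rs)
    (fun (r s : {nonneg R}) rs => @ell1_dual_restr_continuous r%:num s%:num rs)
    (fun (r : {nonneg R}) rr => @ell1_dual_restr_id r%:num rr)
    (fun (r s t : {nonneg R}) rs st rt => @ell1_dual_restr_comp r%:num s%:num t%:num rs st rt).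

Definition linf_norm r b : \bar R :=
  ereal_sup [set (normc (b g) / weight r g)%:E | g in [set: G]].

Lemma linf_norm_ge r b g : ((normc (b g) / weight r g)%:E <= linf_norm r b)%E.
Proof. by apply: ereal_sup_ubound; exists g. Qed.

Lemma linf_norm_ge0 r b : (0 <= linf_norm r b)%E.
Proof.
apply: le_trans (linf_norm_ge r b 1%g).
by rewrite lee_fin divr_ge0 ?normc_ge0 ?weight_ge0.
Qed.

Lemma linf_normD r a b : (linf_norm r (a + b)%R <= linf_norm r a + linf_norm r b)%E.
Proof.
apply: ge_ereal_sup => _ [g _ <-].
apply: le_trans (leeD (linf_norm_ge r a g) (linf_norm_ge r b g)).
rewrite -EFinD lee_fin -mulrDl ler_wpM2r ?invr_ge0 ?weight_ge0//.
exact: le_normcD.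
Qed.

Lemma linf_normZ_le r c a : (linf_norm r (c *: a) <= (normc c)%:E * linf_norm r a)%E.
Proof.
apply: ge_ereal_sup => _ [g _ <-].
rewrite [X in normc X](_ : _ = c * a g)// normcM -mulrA EFinM.
by rewrite lee_wpmul2l ?lee_fin ?normc_ge0// linf_norm_ge.
Qed.

Lemma linf_normZ r c a : linf_norm r (c *: a) = ((normc c)%:E * linf_norm r a)%E.
Proof.
apply/eqP; rewrite eq_le linf_normZ_le/=.
have [->|c0] := eqVneq c 0; first by rewrite normc0 mul0e linf_norm_ge0.
have nc0 : normc c != 0 by apply: contra_neq c0 => /eq0_normc.
have := linf_normZ_le r c^-1 (c *: a); rewrite scalerA mulVf// scale1r.
move=> /(lee_wpmul2l (x := (normc c)%:E)); rewrite lee_fin normc_ge0 => /(_ erefl).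
by rewrite muleA -EFinM normcV divff// mul1e.
Qed.

Lemma linf_norm_le r s b : r <= s -> (linf_norm s b <= linf_norm r b)%E.
Proof.
move=> rs; apply: ge_ereal_sup => _ [g _ <-]; apply: le_trans (linf_norm_ge r b g).
by rewrite lee_fin ler_wpM2l ?normc_ge0// lef_pV2 ?posrE ?weight_gt0// weight_le.
Qed.

Lemma linf_norm0 r : linf_norm r 0 = 0%E.
Proof. by rewrite -[in LHS](scale0r (0 : G -> R[i]^o)) linf_normZ normc0 mul0e. Qed.

Lemma linf_norm_lty r c a b : (linf_norm r a < +oo)%E -> (linf_norm r b < +oo)%E ->
  (linf_norm r (c *: a + b)%R < +oo)%E.
Proof.
move=> ra rb; apply: le_lt_trans (linf_normD _ _ _) _.
by rewrite linf_normZ lte_add_pinfty// lte_mul_pinfty// lee_fin normc_ge0.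
Qed.

Lemma linf_norm_fin r b : (linf_norm r b < +oo)%E -> linf_norm r b \is a fin_num.
Proof. by move=> rb; rewrite ge0_fin_numE// linf_norm_ge0. Qed.

Definition linf_pred r : {pred G -> R[i]^o} :=
  [pred b | `[< (linf_norm r b < +oo)%E >]].

Lemma linf_pred_submod r : submod_closed (linf_pred r).
Proof.
split; first by apply/asboolP; rewrite linf_norm0.
by move=> c a b /asboolP ra /asboolP rb; apply/asboolP/linf_norm_lty.
Qed.

HB.instance Definition _ r := GRing.isSubmodClosed.Build R[i] (G -> R[i]^o)
  (linf_pred r) (GRing.submod_closed_semi (linf_pred_submod r)).

Definition linf_carrier r := submod_of (linf_pred r).
HB.instance Definition _ r := GRing.Lmodule.on (linf_carrier r).

Lemma linf_carrier_lty r (b : linf_carrier r) : (linf_norm r (val b) < +oo)%E.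
Proof. by have /asboolP := valP b. Qed.

Definition fine_linf_norm r (b : linf_carrier r) : R := fine (linf_norm r (val b)).

Lemma fine_linf_normD r (a b : linf_carrier r) :
  fine_linf_norm (a + b) <= fine_linf_norm a + fine_linf_norm b.
Proof.
rewrite -fineD ?linf_norm_fin ?linf_carrier_lty//.
rewrite fine_le ?fin_numD ?linf_norm_fin ?linf_carrier_lty//.
exact: linf_normD.
Qed.

Lemma fine_linf_normZ r c (b : linf_carrier r) :
  fine_linf_norm (c *: b) = normc c * fine_linf_norm b.
Proof.
rewrite /fine_linf_norm [val _](_ : _ = c *: val b)// linf_normZ.
by rewrite fineM// linf_norm_fin ?linf_carrier_lty.
Qed.

Definition linf_seminorm r : seminorm (linf_carrier r) :=
  Seminorm (@fine_linf_normD r) (@fine_linf_normZ r).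

(* [linf r] is the space with the negative weight exponent [-r]. *)
Definition linf r : tvsType R[i] := seminormed (linf_seminorm r).

Section linf_inclusion.
Variables (r s : R) (rs : r <= s).

Lemma linf_incl_subproof (b : linf_carrier r) : val b \in linf_pred s.
Proof.
apply/asboolP; apply: le_lt_trans (linf_carrier_lty b); exact: linf_norm_le.
Qed.

Definition linf_incl (b : linf r) : linf s :=
  exist (fun b => b \in linf_pred s) _ (linf_incl_subproof b).

Lemma linf_incl_linear : linear linf_incl.
Proof. by move=> c a b; apply/val_inj. Qed.

HB.instance Definition _ := GRing.isLinear.Build R[i] (linf r) (linf s) *:%R
  linf_incl linf_incl_linear.

Lemma linf_incl_continuous : continuous linf_incl.
Proof.
apply: lcspace_continuous => -[]; exists tt => b.
by apply: fine_le; rewrite ?linf_norm_fin ?linf_carrier_lty ?linf_norm_le.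
Qed.

End linf_inclusion.

Lemma linf_incl_id r (rr : r <= r) (b : linf r) : linf_incl rr b = b.
Proof. exact/val_inj. Qed.

Lemma linf_incl_comp r s t (rs : r <= s) (st : s <= t) (rt : r <= t) (b : linf r) :
  linf_incl st (linf_incl rs b) = linf_incl rt b.
Proof. exact/val_inj. Qed.

Definition linf_system : inductive_system R[i] {nonneg R} :=
  @InductiveSystem _ _ {nonneg R} (fun r : {nonneg R} => linf r%:num)
    (fun (r s : {nonneg R}) rs => @linf_incl r%:num s%:num rs)
    (fun (r s : {nonneg R}) rs => @linf_incl_continuous r%:num s%:num rs)
    (fun (r : {nonneg R}) rr => @linf_incl_id r%:num rr)
    (fun (r s t : {nonneg R}) rs st rt => @linf_incl_comp r%:num s%:num t%:num rs st rt).

Definition linf_union_pred : {pred G -> R[i]^o} :=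
  [pred b | `[< exists2 r, 0 <= r & (linf_norm r b < +oo)%E >]].

Lemma linf_union_pred_submod : submod_closed linf_union_pred.
Proof.
split; first by apply/asboolP; exists 0; rewrite ?linf_norm0.
move=> c a b /asboolP[r r0 ra] /asboolP[s s0 sb]; apply/asboolP.
exists (Num.max r s); first by rewrite le_max r0.
apply: linf_norm_lty; [apply: le_lt_trans ra|apply: le_lt_trans sb];
  by apply: linf_norm_le; rewrite le_max lexx ?orbT.
Qed.

HB.instance Definition _ := GRing.isSubmodClosed.Build R[i] (G -> R[i]^o)
  linf_union_pred (GRing.submod_closed_semi linf_union_pred_submod).

Definition linf_union : lmodType R[i] := submod_of linf_union_pred.

Lemma linf_to_union_subproof (r : {nonneg R}) (b : linf_carrier r%:num) :
  val b \in linf_union_pred.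
Proof. by apply/asboolP; exists r%:num => //; exact: linf_carrier_lty. Qed.

Definition linf_to_union (r : {nonneg R}) (b : linf r%:num) : linf_union :=
  exist (fun b => b \in linf_union_pred) _ (linf_to_union_subproof b).

Lemma linf_to_union_linear (r : {nonneg R}) : linear (@linf_to_union r).
Proof. by move=> c a b; apply/val_inj. Qed.

HB.instance Definition _ (r : {nonneg R}) := GRing.isLinear.Build R[i] (linf r%:num) linf_union
  *:%R (@linf_to_union r) (@linf_to_union_linear r).

End weighted_spaces.

(* tr(ba) = t, as an unconditionally convergent sum over the group. *)
Definition tr_is (R : realType) (G : groupType) (b a : G -> R[i]^o) (t : R[i]^o) :=
  summability.partial_sum (fun g => b g * a (g^-1)%g) @ summability.totally --> t.

(* Main.v *)
(* A functional in the dual of A_sigma is bounded for one of the norms, hence is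
   [a |-> tr(ba)] with [b g] its value at the unit vector of [g^-1]; this gives
   the algebraic statements.  For the topology, write [t g = sigma (L g)] and let
   [V] be a convex set of coefficient functions [b] that contains, for every
   [n], all [b] with [|b g| <= eps n * t g ^+ n].  For thresholds [th n] that
   grow fast enough, the weight [v] equal to [eps n * t ^+ n / 2 ^ n.+1] on the
   shell [th n <= t < th n.+1] has two properties.  First, every [t ^+ r] is
   bounded by a multiple of [v], so that the unit vectors divided by [v] form a
   bounded set.  Second, if [|b| <= v] and [b] has polynomial growth in [t], then
   [b] lies in [V]: it is a convex combination, with coefficients [2 ^- n.+1], of
   its rescaled restrictions to finitely many shells and of a tail that is small
   for the next exponent.  Hence [V] contains the polar of a bounded set. *)
Require Import Defs.
From HB Require Import structures.
From mathcomp Require Import all_boot all_order all_algebra finmap complex.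
From mathcomp Require Import all_classical all_reals all_analysis.
From mathcomp Require summability.

Set Implicit Arguments.
Unset Strict Implicit.
Unset Printing Implicit Defensive.

Import Order.TTheory GRing.Theory Num.Theory.
Import numFieldNormedType.Exports.
Import Normc.

Local Open Scope classical_set_scope.
Local Open Scope ring_scope.

(** * Diagonal construction of a weight *)

(** Closure of [V] under midpoints can stand in for convexity, because the coefficients [2 ^- n.+1]
    arise by repeated halving. *)
Lemma diagonal_weight (R : realType) (T : Type) (t : T -> R) (eps : nat -> R)
    (V : set (T -> R[i])) :
  (forall g, 1 <= t g) -> (forall n, 0 < eps n) ->
  (forall n b, (forall g, normc (b g) <= eps n * t g ^+ n) -> V b) ->
  (forall b c, V b -> V c -> V (fun g => 2^-1 * (b g + c g))) ->
  exists v : T -> R, [/\ forall g, 0 < v g,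
    forall n, exists M, forall g, t g ^+ n <= M * v g &
    forall n C b, (forall g, normc (b g) <= C * t g ^+ n) ->
      (forall g, normc (b g) <= v g) -> V b].
Proof.
move=> t1 eps0 Veps Vmid.
have t0 g : 0 < t g by exact: lt_le_trans (t1 g).
pose D n : R := 2 ^+ n.+1 / eps n.
have D0 n : 0 < D n by rewrite divr_gt0 ?exprn_gt0.
(* [D i.+1 <= th i.+1] bounds [t ^+ r] by [v] on the shells above [r];
   [4 ^+ n <= th n] makes the rescaled tail of level [n] small. *)
pose th n : R := 1 + \sum_(i < n) (4 ^+ i.+1 + D i.+1).
have thS n : th n.+1 = th n + (4 ^+ n.+1 + D n.+1).
  by rewrite /th big_ord_recr /= addrA.
have th_mono : {homo th : m n / (m <= n)%N >-> m <= n}.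
  apply: homo_leq => [//|? ? ?|n]; first exact: le_trans.
  by rewrite thS lerDl addr_ge0 ?exprn_ge0 ?(ltW (D0 _)).
have th1 n : 1 <= th n.
  by have := th_mono 0 n (leq0n _); rewrite {1}/th big_ord0 addr0.
have th0 n : 0 <= th n by exact: le_trans (th1 n).
have th4 n : 4 ^+ n <= th n.
  case: n => [|n]; first by rewrite expr0 th1.
  by rewrite thS addrCA lerDl addr_ge0 ?(ltW (D0 _))// th0.
have thD n : D n.+1 <= th n.+1.
  by rewrite thS addrA lerDr addr_ge0 ?exprn_ge0// th0.
(* The shells cover everything: [th n] is at least [4 ^+ n], hence unbounded, and the least [n] with
   [t g < th n.+1] satisfies the lower bound by minimality or, for [n = 0], because [th 0 = 1]. *)
have idxP g : exists n, th n <= t g < th n.+1.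
  have ex : exists n, t g < th n.+1.
    exists (Num.trunc (t g)); apply: lt_le_trans (th4 _).
    apply: (lt_le_trans (y := (Num.trunc (t g)).+1%:R)).
      by rewrite truncnS_gt.
    by rewrite -natrX ler_nat ltnW// ltn_expl.
  case: (ex_minnP ex) => -[|n] tn nmin; last first.
    exists n.+1; rewrite tn andbT leNgt; apply/negP => /nmin.
    by rewrite ltnn.
  by exists 0%N; rewrite tn andbT /th big_ord0 addr0.
have {idxP}[idx idxP] := boolp.choice idxP.
have idx_uniq n g : th n <= t g < th n.+1 -> idx g = n.
  have /andP[h1 h2] := idxP g => /andP[h3 h4].
  have [gn|ng|//] := ltngtP (idx g) n.
    by have := lt_le_trans h2 (le_trans (th_mono _ _ gn) h3); rewrite ltxx.
  by have := lt_le_trans h4 (le_trans (th_mono _ _ ng) h1); rewrite ltxx.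
pose v g := t g ^+ idx g / D (idx g).
have v0 g : 0 < v g by rewrite divr_gt0 ?exprn_gt0.
exists v; split => //.
  move=> r; have Dth0 : 0 <= D 0 + th r by rewrite addr_ge0 ?(ltW (D0 _)).
  (* The summand 1 serves the shells of index above [r], where [v g] itself dominates [t g ^+ r].
     The other summand serves the shells of index at most [r], where [t g < th r.+1] and
     [D (idx g) <= D 0 + th r]. *)
  exists (1 + th r.+1 ^+ r * (D 0 + th r)) => g.
  have /andP[h1 h2] := idxP g.
  have [rn|nr] := ltnP r (idx g).
    rewrite mulrDl mul1r ler_wpDr//.
      by apply: mulr_ge0 (ltW (v0 g)); apply: mulr_ge0 => //; apply: exprn_ge0.
    rewrite /v ler_pdivlMr//.
    case: (idx g) rn h1 {h2} => // n; rewrite ltnS => rn h1.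
    rewrite exprS mulrC ler_pM ?exprn_ge0 ?(ltW (D0 _))//.
    - exact: ltW.
    - exact: le_trans (thD _) h1.
    - exact: ler_weXn2l.
  rewrite mulrDl mul1r ler_wpDl ?(ltW (v0 g))// -mulrA.
  apply: (le_trans (y := th r.+1 ^+ r)).
    apply: lerXn2r; rewrite ?nnegrE ?(ltW (t0 _))//.
    by apply: ltW; apply: lt_le_trans h2 _; exact: th_mono.
  rewrite ler_peMr ?exprn_ge0//.
  rewrite /v mulrA ler_pdivlMr// mul1r.
  apply: (le_trans (y := D 0 + th r)); last first.
    by rewrite ler_peMr ?exprn_ege1.
  case: (idx g) nr {h1 h2} => [|n] nr; first by rewrite lerDl.
  apply: le_trans (thD _) _; apply: le_trans (th_mono _ _ nr) _.
  by rewrite lerDr ltW.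
move=> m C b bC bv.
have norm2 n z : normc ((2 ^+ n : R)%:C%C * z) = 2 ^+ n * normc z.
  by rewrite normcM normc_real ger0_norm// exprn_ge0.
(* The powers of 2 make [tail n] the midpoint of [shell n] and [tail n.+1], so membership in [V]
   descends from any tail to [tail 0], which is [b]. *)
pose tail n g := if th n <= t g then (2 ^+ n : R)%:C%C * b g else 0.
pose shell n g := if th n <= t g < th n.+1 then (2 ^+ n.+1 : R)%:C%C * b g else 0.
have shellV n : V (shell n).
  apply: (Veps n) => g; rewrite /shell; case: ifPn => [/idx_uniq gn|_]; last first.
    by rewrite normc0 mulr_ge0 ?(ltW (eps0 n)) ?exprn_ge0 ?(ltW (t0 _)).
  rewrite norm2; apply: (le_trans (y := 2 ^+ n.+1 * v g)).
    by rewrite ler_wpM2l ?exprn_ge0.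
  (* On shell [n], [2 ^+ n.+1 * v g] is exactly [eps n * t g ^+ n]. *)
  have -> : 2 ^+ n.+1 = eps n * D n by rewrite mulrC divfK// gt_eqF.
  by rewrite /v gn -mulrA [D n * _]mulrC divfK// gt_eqF.
have tailE n : tail n = (fun g => 2^-1 * (shell n g + tail n.+1 g)).
  apply/funext => g; rewrite /tail /shell.
  have half z : (2 ^+ n : R)%:C%C * z = 2^-1 * ((2 ^+ n.+1 : R)%:C%C * z).
    by rewrite exprS rmorphM/= rmorphMn/= mulrA mulrA mulVf ?mul1r// pnatr_eq0.
  case: (leP (th n.+1) (t g)) => h /=.
    by rewrite (le_trans (th_mono _ _ (leqnSn n)) h) add0r half.
  by rewrite andbT addr0; case: ifP => _; rewrite ?mulr0// half.
have tailV n : V (tail n) -> V (tail 0).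
  by elim: n => // n IH Vn; apply: IH; rewrite tailE; exact: Vmid.
have -> : b = tail 0.
  by apply/funext => g; rewrite /tail /th big_ord0 addr0 t1 expr0 mul1r.
(* This [N] gives [C <= eps m.+1 * 2 ^+ N]. Where [th N <= t g], the additional factor
   [t g >= 4 ^+ N] absorbs both this [2 ^+ N] and the one in [tail N]. *)
pose N := (Num.trunc (C / eps m.+1)).+1.
apply: (tailV N); apply: (Veps m.+1) => g; rewrite /tail.
case: ifPn => [hN|_]; last first.
  by rewrite normc0 mulr_ge0 ?(ltW (eps0 _)) ?exprn_ge0 ?(ltW (t0 _)).
rewrite norm2; apply: (le_trans (y := 2 ^+ N * (C * t g ^+ m))).
  by rewrite ler_wpM2l ?exprn_ge0.
rewrite exprS !mulrA ler_pM2r ?exprn_gt0//.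
have CN : C <= eps m.+1 * 2 ^+ N.
  rewrite mulrC -ler_pdivrMr//; apply: (le_trans (y := N%:R)).
    by rewrite ltW// truncnS_gt.
  by rewrite -natrX ler_nat ltnW// ltn_expl.
apply: (le_trans (y := 2 ^+ N * (eps m.+1 * 2 ^+ N))).
  by rewrite ler_wpM2l ?exprn_ge0.
rewrite mulrCA ler_wpM2l ?(ltW (eps0 _))//.
apply: le_trans hN; apply: le_trans (th4 _).
by rewrite -exprMn -natrM.
Qed.

(** * Unconditional convergence of complex families *)

Section unconditional_sums.
Variables (R : realType) (I : choiceType).
Implicit Types (x y : I -> R[i]^o) (l : R[i]^o).

Lemma partial_sumE (V : zmodType) (x : I -> V) (A : {fset I}) :
  summability.partial_sum x A = \sum_(i <- A) x i.
Proof. by rewrite /summability.partial_sum big_seq_fsetE. Qed.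

Lemma cvg_totallyP x l :
  summability.partial_sum x @ summability.totally --> l <->
  forall e : R, 0 < e -> exists A : {fset I}, forall B : {fset I},
    (A `<=` B)%fset -> normc (l - \sum_(i <- B) x i) < e.
Proof.
have FF := @summability.totally_filter I.
split=> [/cvgrPdist_lt xl e e0|xl].
  have [|A _ AB] := xl e%:C%C; first by rewrite ltcR.
  by exists A => B /AB /=; rewrite partial_sumE normc_realE ltcR.
(* A positive element of [R[i]] has zero imaginary part, so only real radii occur. *)
apply/cvgrPdist_lt => -[e e'] /[!ltcE]/= /andP[/eqP -> e0].
have [A AB] := xl e e0; exists A => // B /AB.
by rewrite partial_sumE normc_realE ltcR.
Qed.

(** The limit is the supremum of the finite sums: a finite sum close to it stays close when terms
    are added. *)
Lemma cvg_totally_nonneg (y : I -> R) (M : R) : (forall i, 0 <= y i) ->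
  (forall A : {fset I}, \sum_(i <- A) y i <= M) ->
  exists l, summability.partial_sum (fun i => (y i)%:C%C : R[i]^o) @
    summability.totally --> l.
Proof.
move=> y0 yM; pose E := [set \sum_(i <- A) y i | A in [set: {fset I}]].
have supE : has_sup E.
  split; first by exists (\sum_(i <- fset0) y i); exists fset0.
  by exists M => _ [A _ <-].
exists (sup E)%:C%C; apply/cvg_totallyP => e e0.
have [_ [A _ <-] Ae] := sup_adherent e0 supE.
exists A => B AB.
rewrite (_ : _ - _ = (sup E - \sum_(i <- B) y i)%:C%C); last first.
  by rewrite rmorphB rmorph_sum.
rewrite normc_real.
have BE : \sum_(i <- B) y i <= sup E.
  by apply: ub_le_sup; [exact: supE.2|exists B].
rewrite ger0_norm ?subr_ge0// ltrBlDr -ltrBlDl; apply: lt_le_trans Ae _.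
rewrite [leRHS](big_fsetID _ (mem A))/= (_ : [fset i in B | i \in A]%fset = A).
  by rewrite lerDl sumr_ge0.
apply/fsetP => i; rewrite !inE/= andbC; case: (boolP (i \in A)) => //= iA.
exact: (fsubsetP AB).
Qed.

(** Real and imaginary parts are summed separately; each real family [y] is the difference of the
    nonnegative families [|y| + y] and [|y|]. *)
Lemma cvg_totally_abs x (M : R) :
  (forall A : {fset I}, \sum_(i <- A) normc (x i) <= M) ->
  exists l, summability.partial_sum x @ summability.totally --> l.
Proof.
move=> xM; have FF := @summability.totally_filter I.
have part (y : I -> R) : (forall i, `|y i| <= normc (x i)) ->
    exists l, summability.partial_sum (fun i => (y i)%:C%C : R[i]^o) @
    summability.totally --> l.
  move=> yx.
  have [l ll] : exists l, summability.partial_sum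
      (fun i => (`|y i| + y i)%:C%C : R[i]^o) @ summability.totally --> l.
    apply: (@cvg_totally_nonneg _ (M + M)) => [i|A].
      by rewrite -lerBlDr sub0r -normrN ler_norm.
    rewrite big_split lerD//; apply: le_trans (xM A); apply: ler_sum => i _.
      exact: yx.
    exact: le_trans (ler_norm _) (yx i).
  have [k kk] : exists l, summability.partial_sum
      (fun i => `|y i|%:C%C : R[i]^o) @ summability.totally --> l.
    apply: (@cvg_totally_nonneg _ M) => [//|A].
    by apply: le_trans (xM A); apply: ler_sum.
  exists (l - k); rewrite (_ : summability.partial_sum _ =
    summability.partial_sum (fun i => (`|y i| + y i)%:C%C : R[i]^o) -
    summability.partial_sum (fun i => `|y i|%:C%C : R[i]^o)).
    exact: cvgB ll kk.
  apply/funext => A; rewrite !fctE !partial_sumE -sumrB; apply: eq_bigr => i _.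
  by rewrite -rmorphB/= [_ + y i]addrC addrK.
have [l ll] : exists l, summability.partial_sum
    (fun i => (complex.Re (x i))%:C%C : R[i]^o) @ summability.totally --> l.
  by apply: part => i; rewrite -lecR -normc_realE; exact: normc_ge_Re.
have [k kk] : exists l, summability.partial_sum
    (fun i => (complex.Im (x i))%:C%C : R[i]^o) @ summability.totally --> l.
  apply: part => i; case: (x i) => a b /=.
  by rewrite -sqrtr_sqr ler_wsqrtr// lerDr sqr_ge0.
exists (l + 'i%C *: k).
rewrite (_ : summability.partial_sum _ =
  summability.partial_sum (fun i => (complex.Re (x i))%:C%C : R[i]^o) +
  (fun A => 'i%C *: summability.partial_sum
    (fun i => (complex.Im (x i))%:C%C : R[i]^o) A)).
  by apply: (@cvgD R[i] R[i]^o) ll _; apply: (@cvgZl_tmp R[i] R[i]^o) kk.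
apply/funext => A; rewrite !fctE !partial_sumE scaler_sumr -big_split.
by apply: eq_bigr => i _; rewrite [LHS]complexE.
Qed.

Lemma cvg_totally_norm_le x l (M : R) :
  summability.partial_sum x @ summability.totally --> l ->
  (forall A : {fset I}, \sum_(i <- A) normc (x i) <= M) -> normc l <= M.
Proof.
move=> /cvg_totallyP xl xM; apply/ler_addgt0Pr => e /xl[A /(_ A)].
move=> /(_ (fsubset_refl A)) le.
rewrite -(subrK (\sum_(i <- A) x i) l); apply: le_trans (le_normcD _ _) _.
rewrite addrC lerD ?(ltW le)//; apply: le_trans (xM A).
elim/big_ind2: _ => //; first by rewrite normc0.
by move=> a b c d ab cd; apply: le_trans (le_normcD _ _) (lerD ab cd).
Qed.

End unconditional_sums.

(** * The trace pairing and its estimates *)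

Section pairing.
Variables (R : realType) (G : groupType) (S : {fset G}).
Variable sigma : growth_function R.
Hypothesis S_inv : forall x, x \in S -> (x^-1)%g \in S.
Implicit Types (a b : G -> R[i]^o) (r : R) (A : {fset G}).
Local Notation ell1_norm := (ell1_norm S sigma).
Local Notation linf_norm := (linf_norm S sigma).
Local Notation weight := (weight S sigma).

(** Reversing a word and inverting its letters gives a word of equal length for the inverse. The
    pairing evaluates [a] at inverses, so the weights must have this symmetry. *)
Lemma word_length_inv g : word_length S (g^-1)%g = word_length S g.
Proof.
have word_inv h s : is_word S h s -> is_word S (h^-1)%g (rev [seq (x^-1)%g | x <- s]).
  move=> [sS <-]; split=> [x|].
    by rewrite mem_rev => /mapP[y ys ->]; exact/S_inv/sS.
  elim: {sS}s => [|x s IH]; first by rewrite !big_nil invg1.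
  by rewrite /= rev_cons -cats1 big_cat big_seq1/= IH big_cons invgM.
have len_inv h n :
    ((exists2 s, is_word S h s & size s = n) /\
      (forall s, is_word S h s -> (n <= size s)%N)) ->
    (exists2 s, is_word S (h^-1)%g s & size s = n) /\
      (forall s, is_word S (h^-1)%g s -> (n <= size s)%N).
  move=> [[s hs <-] hmin]; split.
    by exists (rev [seq (x^-1)%g | x <- s]); [exact: word_inv|rewrite size_rev size_map].
  move=> s' /word_inv; rewrite invgK => /hmin.
  by rewrite size_rev size_map.
(* The two sets of lengths are equal, so [get] returns the same value, its default included. *)
congr (get _); apply/seteqP; split => n /len_inv //=.
by rewrite invgK.
Qed.

Lemma weight_inv r g : weight r (g^-1)%g = weight r g.
Proof. by rewrite /Defs.weight word_length_inv. Qed.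

Lemma ell1_norm_inv r a : ell1_norm r (fun g => a (g^-1)%g) = ell1_norm r a.
Proof.
rewrite /Defs.ell1_norm [RHS](reindex_esum [set: G] _ (fun g => (g^-1)%g)).
  by apply: eq_esum => g _; rewrite weight_inv.
split => //; first by move=> x y _ _; exact: invg_inj.
by move=> g _; exists (g^-1)%g => //; rewrite invgK.
Qed.

Lemma sum_le_ell1_norm r a A :
  ((\sum_(g <- A) normc (a g) * weight r g)%:E <= ell1_norm r a)%E.
Proof.
apply: esum_ge; exists [set` A]; first by split.
by rewrite -fsbig_seq// sumEFin.
Qed.

Lemma linf_coef_le r b g : (linf_norm r b < +oo)%E ->
  normc (b g) <= fine (linf_norm r b) * weight r g.
Proof.
move=> rb; rewrite -ler_pdivrMr ?weight_gt0// -lee_fin fineK ?linf_norm_fin//.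
exact: linf_norm_ge.
Qed.

Lemma linf_norm_le_coef r b (M : R) :
  (forall g, normc (b g) <= M * weight r g) -> (linf_norm r b <= M%:E)%E.
Proof.
move=> bM; apply: ge_ereal_sup => _ [g _ <-].
by rewrite lee_fin ler_pdivrMr ?weight_gt0.
Qed.

(** Bounding [b] by its norm times the weight leaves a weighted sum of [a] over inverses, which
    [ell1_norm_inv] controls. *)
Lemma sum_pairing_le r b a A :
  (linf_norm r b < +oo)%E -> (ell1_norm r a < +oo)%E ->
  \sum_(g <- A) normc (b g * a (g^-1)%g : R[i]) <=
    fine (linf_norm r b) * fine (ell1_norm r a).
Proof.
move=> rb ra; apply: (le_trans (y := fine (linf_norm r b) *
    \sum_(g <- A) normc (a (g^-1)%g) * weight r g)).
  rewrite mulr_sumr; apply: ler_sum => g _.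
  rewrite normcM mulrCA [leLHS]mulrC ler_wpM2l ?normc_ge0//.
  exact: linf_coef_le.
rewrite ler_wpM2l ?fine_ge0 ?linf_norm_ge0//.
rewrite -lee_fin fineK ?ell1_norm_fin// -ell1_norm_inv.
exact: sum_le_ell1_norm.
Qed.

(** The limit is meaningful only if the sums converge; [pairing_tr] ensures this when both norms are
    finite for one exponent. *)
Definition pairing b a : R[i]^o :=
  lim (summability.partial_sum (fun g => b g * a (g^-1)%g) @ summability.totally).

Lemma pairing_unique b a t : tr_is b a t -> pairing b a = t.
Proof.
move=> h; have FF := @summability.totally_filter G.
by apply: cvg_lim => //; exact: norm_hausdorff.
Qed.

Lemma pairing_tr r b a :
  (linf_norm r b < +oo)%E -> (ell1_norm r a < +oo)%E -> tr_is b a (pairing b a).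
Proof.
move=> rb ra.
have [l ll] := cvg_totally_abs (fun A => sum_pairing_le A rb ra).
by rewrite (pairing_unique ll).
Qed.

Lemma pairing_le r b a :
  (linf_norm r b < +oo)%E -> (ell1_norm r a < +oo)%E ->
  normc (pairing b a) <= fine (linf_norm r b) * fine (ell1_norm r a).
Proof.
move=> rb ra; apply: (cvg_totally_norm_le (pairing_tr rb ra)) => A.
exact: sum_pairing_le.
Qed.

Lemma pairing_linearr r b a a' c :
  (linf_norm r b < +oo)%E -> (ell1_norm r a < +oo)%E ->
  (ell1_norm r a' < +oo)%E ->
  pairing b (c *: a + a') = c *: pairing b a + pairing b a'.
Proof.
move=> rb ra ra'; apply: pairing_unique; rewrite /tr_is.
have FF := @summability.totally_filter G.
rewrite (_ : summability.partial_sum _ =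
    (fun A => c *: summability.partial_sum (fun g => b g * a (g^-1)%g) A) +
    summability.partial_sum (fun g => b g * a' (g^-1)%g)).
  apply: (@cvgD R[i] R[i]^o); last exact: pairing_tr rb ra'.
  by apply: (@cvgZl_tmp R[i] R[i]^o); exact: pairing_tr rb ra.
apply/funext => A; rewrite !fctE !partial_sumE scaler_sumr -big_split.
apply: eq_bigr => g _.
transitivity (b g * (c * a (g^-1)%g + a' (g^-1)%g) : R[i]); first by [].
by rewrite mulrDr mulrCA.
Qed.

Lemma pairing_linearl r b b' a c :
  (linf_norm r b < +oo)%E -> (linf_norm r b' < +oo)%E ->
  (ell1_norm r a < +oo)%E ->
  pairing (c *: b + b') a = c *: pairing b a + pairing b' a.
Proof.
move=> rb rb' ra; apply: pairing_unique; rewrite /tr_is.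
have FF := @summability.totally_filter G.
rewrite (_ : summability.partial_sum _ =
    (fun A => c *: summability.partial_sum (fun g => b g * a (g^-1)%g) A) +
    summability.partial_sum (fun g => b' g * a (g^-1)%g)).
  apply: (@cvgD R[i] R[i]^o); last exact: pairing_tr rb' ra.
  by apply: (@cvgZl_tmp R[i] R[i]^o); exact: pairing_tr rb ra.
apply/funext => A; rewrite !fctE !partial_sumE scaler_sumr -big_split.
apply: eq_bigr => g _.
transitivity ((c * b g + b' g) * a (g^-1)%g : R[i]); first by [].
by rewrite mulrDl -mulrA.
Qed.

Definition delta (g : G) : G -> R[i]^o := fun h => (h == g)%:R.

Lemma pairing_delta b g : pairing b (delta (g^-1)%g) = b g.
Proof.
apply: pairing_unique; apply/cvg_totallyP => e e0.
(* Every finite sum whose index set contains [g] already equals [b g]. *)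
exists [fset g]%fset => B gB; rewrite (bigD1_seq g)/= ?fset_uniq//; last first.
  by apply: (fsubsetP gB); rewrite inE.
rewrite /delta eqxx mulr1 big1 ?addr0 ?subrr ?normc0// => h hg.
by rewrite (inj_eq invg_inj) (negbTE hg) mulr0.
Qed.

Lemma ell1_norm_delta r g : ell1_norm r (delta g) = (weight r g)%:E.
Proof.
rewrite -[RHS](@esum_set1 _ _ g (fun h => (weight r h)%:E)) ?lee_fin ?weight_ge0//.
rewrite [RHS]esum_mkcond; apply: eq_esum => h _; rewrite /delta.
have [->|hg] := eqVneq h g; first by rewrite mem_set// normc1 mul1r.
by rewrite memNset ?normc0 ?mul0r//; exact/eqP.
Qed.

(** The norm splits over a finite set and its complement; a finite set that almost attains the
    supremum leaves less than [e] for the complement. *)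
Lemma ell1_tail r a (e : R) : 0 < e -> (ell1_norm r a < +oo)%E ->
  exists A : {fset G},
    (ell1_norm r (a - \sum_(g <- A) a g *: delta g)%R < e%:E)%E.
Proof.
move=> e0 ra.
have [_ [X [finX _] <-] eX] := ub_ereal_sup_adherent e0 (ell1_norm_fin ra).
exists (fset_set X).
rewrite -/(esum _ _) -/(ell1_norm r a) in eX.
have headE h : (\sum_(g <- fset_set X) a g *: delta g : G -> R[i]^o) h =
    if h \in X then a h else 0.
  rewrite -(in_fset_set finX) fct_sumE.
  case: ifPn => hX.
    rewrite (bigD1_seq h)/= ?fset_uniq// big1 => [|g gh].
      by rewrite /delta !fctE eqxx addr0 -[RHS]mulr1.
    by rewrite /delta !fctE eq_sym (negbTE gh) scaler0.
  rewrite big_seq big1 // => g gX; rewrite /delta !fctE.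
  by case: eqVneq => [hg|_]; [rewrite hg gX in hX|rewrite scaler0].
have normE h : (0 <= (normc (a h) * weight r h)%:E)%E.
  by rewrite lee_fin mulr_ge0 ?normc_ge0 ?weight_ge0.
have split_norm : ell1_norm r a = (\sum_(h \in X) (normc (a h) * weight r h)%:E +
    ell1_norm r (a - \sum_(g <- fset_set X) a g *: delta g)%R)%E.
  rewrite [LHS](esumID X)//; congr (_ + _)%E; rewrite setTI.
    by rewrite esum_fset// => h _; exact: normE.
  rewrite esum_mkcond; apply: eq_esum => h _.
  rewrite !fctE headE in_setC; case: ifPn => hX /=.
    by rewrite (negbTE hX) subr0.
  by rewrite (negPn hX) subrr normc0 mul0r.
by move: eX; rewrite split_norm fsumEFin// lteBlDr// lteD2lE.
Qed.

(* The finitely supported elements are dense in the weighted [ell1] spaces, so a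
   bounded functional is determined by its values on the [delta g]. *)
Lemma ell1_functional_eq0 (E : lmodType R[i]) (v : {linear E -> (G -> R[i]^o)})
    (d : G -> E) (phi : {linear E -> R[i]^o}) r (C : R) :
  (forall x, (ell1_norm r (v x) < +oo)%E) -> (forall g, v (d g) = delta g) ->
  (forall x, normc (phi x) <= C * fine (ell1_norm r (v x))) ->
  (forall g, phi (d g) = 0) -> forall x, phi x = 0.
Proof.
move=> vfin vd phiC phid x; apply: eq0_normc; apply: le_anti.
rewrite normc_ge0 andbT; apply/ler_addgt0Pr => e e0; rewrite add0r.
(* [C] may have any sign; [D] is a positive constant that also bounds [phi]. *)
pose D := `|C| + 1.
have D0 : 0 < D by rewrite ltr_wpDl.
have [A Ae] := ell1_tail (divr_gt0 e0 D0) (vfin x).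
pose y := \sum_(g <- A) v x g *: d g.
have -> : phi x = phi (x - y).
  rewrite linearB linear_sum big1 ?subr0// => g _.
  by rewrite linearZ_LR phid scaler0.
apply: le_trans (phiC _) _.
have vxy : v (x - y) = v x - \sum_(g <- A) v x g *: delta g.
  rewrite linearB linear_sum; congr (_ - _); apply: eq_bigr => g _.
  by rewrite linearZ_LR vd.
apply: (le_trans (y := D * fine (ell1_norm r (v (x - y))))).
  rewrite ler_wpM2r ?fine_ge0 ?ell1_norm_ge0//.
  by rewrite ler_wpDr// ler_norm.
rewrite mulrC -ler_pdivlMr// -lee_fin fineK ?ell1_norm_fin//.
by rewrite vxy ltW.
Qed.

End pairing.

(** * Linear maps and bounded sets in spaces defined by seminorms *)

Definition linear_of (K : pzRingType) (U V : lmodType K) (f : U -> V)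
    (lf : linear f) : {linear U -> V} :=
  HB.pack f (GRing.isLinear.Build K U V *:%R f lf).

Lemma linear_continuous0 (K : numDomainType) (E F : tvsType K)
    (f : {linear E -> F}) :
  (forall U, nbhs 0 U -> nbhs 0 (f @^-1` U)) -> continuous f.
Proof.
move=> f0 x U Ux.
have := nbhsB (- f x) Ux; rewrite addNr => /f0 /(nbhsB x); rewrite addr0.
apply: filterS => _ [z [u Uu uz] <-] /=.
by rewrite linearD -uz addrA subrr add0r.
Qed.

Lemma nbhs0_normcP (R : realType) (U : set R[i]^o) :
  nbhs (0 : R[i]^o) U <->
  exists2 e : R, 0 < e & [set z | normc z < e] `<=` U.
Proof.
split=> [/nbhs_ballP[[e e'] /=]|[e e0 eU]].
  rewrite ltcE/= => /andP[/eqP -> e0] eU; exists e => // z ze; apply: eU.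
  by rewrite -ball_normE /= sub0r normrN normc_realE ltcR.
apply/nbhs_ballP; exists e%:C%C => /=; first by rewrite ltcR.
by move=> z; rewrite -ball_normE /= sub0r normrN normc_realE ltcR => /eU.
Qed.

(** Serves to normalise by a seminorm value [q] that may vanish: one divides by any [t > q] and lets
    [t] tend to [q]. *)
Lemma ler_mul_limit (R : realFieldType) (C q y : R) : 0 <= C ->
  (forall t, q < t -> y <= C * t) -> y <= C * q.
Proof.
move=> C0 yt; have C1 : 0 < C + 1 by rewrite ltr_wpDl.
apply/ler_addgt0Pr => e e0; apply: le_trans (yt (q + e / (C + 1)) _) _.
  by rewrite ltrDl divr_gt0.
rewrite mulrDr lerD2l mulrCA ler_piMr ?(ltW e0)//.
by rewrite ler_pdivrMr// mul1r lerDl.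
Qed.

Section seminorm_topology.
Variables (R : realType) (E : lmodType R[i]) (I : Type) (p : I -> seminorm E).
Local Notation T := (lcspace p).

Lemma lcspace_nbhs0_lt i (e : R) : 0 < e -> nbhs (0 : T) [set x | p i x < e].
Proof.
by move=> e0; exists [:: i], e; split => // x; rewrite /sn_ball/= subr0 andbT.
Qed.

Lemma lcspace_nbhs0_lt_bound (q : E -> R) i (C e : R) :
  (forall x, q x <= C * p i x) -> 0 < e -> nbhs (0 : T) [set x | q x < e].
Proof.
move=> qC e0; have C0 : 0 < `|C| + 1 by rewrite ltr_wpDl.
have := lcspace_nbhs0_lt i (divr_gt0 e0 C0); apply: filterS => x /=.
rewrite ltr_pdivlMr// mulrC; apply: le_lt_trans; apply: le_trans (qC x) _.
by rewrite ler_wpM2r ?sn_ge0// ler_wpDr// ler_norm.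
Qed.

Lemma lcspace_continuous_bound (F : lmodType R[i]) (J : Type)
    (q : J -> seminorm F) (f : {linear T -> lcspace q}) :
  (forall j, exists i C, forall x : E, q j (f x) <= C * p i x) -> continuous f.
Proof.
move=> fq; apply: linear_continuous0 => U [s [e [e0 sU]]].
apply: (@filterS _ (nbhs (0 : T)) _ [set x | all (fun j => q j (f x) < e) s]).
  by move=> x xs; apply: sU; rewrite /sn_ball/=; under eq_all do rewrite subr0.
elim: s {sU} => [|j s IH]; first exact: filterE.
have [i [C fC]] := fq j.
by apply: filterS (filterI (lcspace_nbhs0_lt_bound fC e0) IH) => x [/= -> ->].
Qed.

Lemma lcspace_functional_continuous (phi : T -> R[i]^o) i (C : R) :
  linear phi -> (forall x : E, normc (phi x) <= C * p i x) -> continuous phi.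
Proof.
move=> lphi phiC.
apply: (@linear_continuous0 _ _ _ (linear_of lphi)) => U /nbhs0_normcP[e e0 eU].
have := lcspace_nbhs0_lt_bound phiC e0.
by apply: filterS => x /eU.
Qed.

(** A neighbourhood of 0 on which [phi] stays below 1 involves finitely many seminorms; directedness
    replaces them by one, and scaling gives the bound. *)
Lemma dual_lcspace_bound (phi : dual T) :
  (forall s : seq I, exists i, forall x : E, all (fun j => p j x <= p i x) s) ->
  exists i C, forall x : E, normc (phi x) <= C * p i x.
Proof.
move=> dir; have [s [e [e0 sU]]] := dual_nbhs0 phi.
have [i si] := dir s; exists i, (2 / e) => x.
have main t : p i x < t -> normc (phi x) <= 2 / e * t.
  move=> xt; have t0 : 0 < t by apply: le_lt_trans xt; exact: sn_ge0.
  have c0 : 0 < e / 2 / t by rewrite !divr_gt0.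
  have : normc (phi ((e / 2 / t)%:C%C *: x)) < 1.
    apply: sU; rewrite /sn_ball/= subr0; apply: sub_all (si x) => j jx.
    rewrite snZ normc_real gtr0_norm// mulrAC ltr_pdivrMr//.
    apply: (le_lt_trans (y := e / 2 * p i x)); first by rewrite ler_wpM2l// ltW// divr_gt0.
    rewrite -mulrA ltr_pM2l// mulrC.
    apply: le_lt_trans xt; rewrite ler_piMr ?sn_ge0//.
    by rewrite invf_le1// ler1n.
  rewrite linearZ_LR normcM normc_real gtr0_norm// mulrC -ltr_pdivlMr// mul1r.
  by rewrite !invfM !invrK => /ltW; rewrite [e^-1 * _]mulrC.
by apply: ler_mul_limit main; rewrite divr_ge0 ?ltW.
Qed.

(** A neighbourhood of 0 involves finitely many seminorms; if all are below [M] on [B], scalars of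
    modulus at least [M / e] dilate it to contain [B]. *)
Lemma lcspace_bounded (B : set T) :
  (forall i, exists M, forall x : E, B x -> p i x <= M) -> tvs_bounded B.
Proof.
move=> Bp U [s [e [e0 sU]]].
have [M M0 BM] : exists2 M, 0 < M & forall x : E, B x -> all (fun j => p j x < M) s.
  elim: s {sU} => [|j s [M M0 IH]]; first by exists 1.
  have [N BN] := Bp j; exists (Num.max M (N + 1)); first by rewrite lt_max M0.
  move=> x Bx; have jN : p j x < N + 1 by apply: le_lt_trans (BN x Bx) _; rewrite ltrDl.
  rewrite /= lt_max jN orbT/=.
  by apply: sub_all (IH x Bx) => i xM; rewrite lt_max xM.
exists (M / e); first by rewrite divr_gt0.
move=> c Mc x Bx.
have c0 : 0 < normc c by apply: lt_le_trans Mc; rewrite divr_gt0.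
have cn0 : c != 0 by apply: contraTneq c0 => ->; rewrite normc0 ltxx.
exists (c^-1 *: x); last by rewrite scalerA divff// scale1r.
apply: sU; rewrite /sn_ball/= subr0; apply: sub_all (BM x Bx) => j xM.
rewrite snZ normcV mulrC ltr_pdivrMr//; apply: lt_le_trans xM _.
by rewrite -ler_pdivrMl// mulrC.
Qed.

Lemma tvs_bounded_seminorm (B : set T) i : tvs_bounded B ->
  exists M, forall x : E, B x -> p i x <= M.
Proof.
move=> /(_ _ (lcspace_nbhs0_lt i ltr01))[s s0 sB]; exists s => x Bx.
have [|u /= u1 <-] := sB s%:C%C _ x Bx; first by rewrite normc_real gtr0_norm.
by rewrite snZ normc_real gtr0_norm// ler_piMr ?ltW.
Qed.

End seminorm_topology.

Lemma dual_norm_ge (R : realType) (E : lmodType R[i]) (N : seminorm E)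
    (phi : normed_dual N) (a : E) :
  normc (dual_fun phi a) <= dual_norm N phi * N a.
Proof.
apply: ler_mul_limit; first exact: sn_ge0.
move=> t Nlt; have t0 : 0 < t by apply: le_lt_trans Nlt; exact: sn_ge0.
have at1 : N (t^-1%:C%C *: a) <= 1.
  by rewrite snZ normc_real gtr0_norm ?invr_gt0// mulrC ler_pdivrMr// mul1r ltW.
have := sup_on_ge (@unit_ball_dual _ _ N) phi at1.
rewrite linearZ_LR normcM normc_real gtr0_norm ?invr_gt0//.
by rewrite mulrC ler_pdivrMr.
Qed.

Lemma convex_midpoint (K : numFieldType) (E : lmodType K) (A : set E) :
  convex_set (A : set (convex_lmodType E)) ->
  forall x y, A x -> A y -> A (2^-1 *: (x + y)).
Proof.
move=> cA x y Ax Ay.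
have h0 : 0 <= 2^-1 :> K by rewrite invr_ge0.
have h1 : 2^-1 <= 1 :> K by rewrite invf_le1// ler1n.
have := cA x y (Itv01 h0 h1); rewrite !inE => /(_ Ax Ay).
have half : 1 - 2^-1 = 2^-1 :> K by rewrite {1}(splitr 1) mul1r addrK.
have -> : conv (Itv01 h0 h1) (x : convex_lmodType E) y =
    2^-1 *: x + (1 - 2^-1) *: y :> E by [].
by rewrite half scalerDr.
Qed.

(** * The dual of A_sigma as a space of coefficient functions *)

Section dual_of_alg.
Variables (R : realType) (G : groupType) (S : {fset G}).
Variable sigma : growth_function R.
Hypothesis S_inv : forall x, x \in S -> (x^-1)%g \in S.
Implicit Types g : G.
Local Notation ell1_norm := (ell1_norm S sigma).
Local Notation linf_norm := (linf_norm S sigma).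
Local Notation weight := (weight S sigma).
Local Notation alg := (alg S sigma).
Local Notation alg_dual := (alg_dual S sigma).
Local Notation ell1 := (ell1 S sigma).
Local Notation ell1_dual := (ell1_dual S sigma).
Local Notation linf := (linf S sigma).
Local Notation linf_union := (linf_union S sigma).
Local Notation linf_to_union := (@linf_to_union R G S sigma).

Lemma delta_ell1_pred r g : delta R g \in ell1_pred S sigma r.
Proof. by apply/asboolP; rewrite ell1_norm_delta ltry. Qed.

Definition ell1_delta r g : ell1 r :=
  exist (fun a => a \in ell1_pred S sigma r) _ (delta_ell1_pred r g).

Lemma delta_alg_pred g : delta R g \in alg_pred S sigma.
Proof. by apply/asboolP => r _; rewrite ell1_norm_delta ltry. Qed.

Definition alg_delta g : alg :=
  exist (fun a => a \in alg_pred S sigma) _ (delta_alg_pred g).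

Lemma alg_seminorm_delta (r : {nonneg R}) g :
  alg_seminorm S sigma r (alg_delta g) = weight r%:num g.
Proof. by rewrite /= /alg_norm ell1_norm_delta. Qed.

(** The norms increase with the exponent, so the sum of the given exponents serves. *)
Lemma alg_seminorm_directed (s : seq {nonneg R}) : exists r, forall x : alg,
  all (fun j => alg_seminorm S sigma j x <= alg_seminorm S sigma r x) s.
Proof.
have mono (i j : {nonneg R}) (x : alg) : i%:num <= j%:num ->
    alg_seminorm S sigma i x <= alg_seminorm S sigma j x.
  move=> ij; apply: fine_le; rewrite ?ell1_norm_fin ?alg_carrier_lty//.
  exact: ell1_norm_le.
elim: s => [|j s [r rs]]; first by exists 0%:nng.
exists (j%:num + r%:num)%:nng => x /=; apply/andP; split.
  by apply: mono; rewrite /= lerDl.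
apply: sub_all (rs x) => k kr; apply: le_trans kr _.
by apply: mono; rewrite /= lerDr.
Qed.

Lemma alg_dual_bound (phi : alg_dual) : exists (r : {nonneg R}) C, forall a : alg,
  normc (dual_fun phi a) <= C * fine (ell1_norm r%:num (val a)).
Proof. exact: dual_lcspace_bound alg_seminorm_directed. Qed.

Lemma alg_dual_eq (phi psi : alg_dual) :
  (forall g, dual_fun phi (alg_delta g) = dual_fun psi (alg_delta g)) -> phi = psi.
Proof.
move=> e; apply/eqP; rewrite -subr_eq0; apply/eqP/dual_eq => a.
have [r [C rC]] := alg_dual_bound (phi - psi).
transitivity (0 : R[i]^o); last by [].
apply: (@ell1_functional_eq0 R G S sigma alg val alg_delta (dual_fun (phi - psi)) r%:num C) => //.
  by move=> x; exact: alg_carrier_lty.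
move=> g; transitivity (dual_fun phi (alg_delta g) - dual_fun psi (alg_delta g)).
  by [].
by rewrite e subrr.
Qed.

(** Makes the restriction of functionals from [ell1 r] to [alg] injective, as the unit vectors lie
    in [alg]. *)
Lemma ell1_dual_eq r (phi psi : ell1_dual r) :
  (forall g, dual_fun phi (ell1_delta r g) = dual_fun psi (ell1_delta r g)) ->
  phi = psi.
Proof.
move=> e; apply/eqP; rewrite -subr_eq0; apply/eqP/dual_eq => a.
have [|_ [C rC]] := dual_lcspace_bound (phi - psi : dual (ell1 r)).
  by move=> s; exists tt => x; apply/allP => -[].
transitivity (0 : R[i]^o); last by [].
apply: (@ell1_functional_eq0 R G S sigma (ell1 r) val (ell1_delta r)
  (dual_fun (phi - psi)) r C) => //.
  by move=> x; exact: ell1_carrier_lty.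
move=> g; transitivity (dual_fun phi (ell1_delta r g) - dual_fun psi (ell1_delta r g)).
  by [].
by rewrite e subrr.
Qed.

Lemma pairing_ell1_dual r (b : linf r) :
  (fun a : ell1 r => pairing (val b) (val a)) \in @dual_pred _ (ell1 r).
Proof.
have lin : linear (fun a : ell1 r => pairing (val b) (val a)).
  by move=> c a a'; apply: (pairing_linearr S_inv); [exact: linf_carrier_lty|
    exact: ell1_carrier_lty|exact: ell1_carrier_lty].
apply/asboolP; split => //.
refine (@lcspace_functional_continuous R (ell1_carrier S sigma r) unit
  (fun=> ell1_seminorm S sigma r) _ tt (fine (linf_norm r (val b))) lin _).
by move=> a; apply: (pairing_le S_inv); [exact: linf_carrier_lty|exact: ell1_carrier_lty].
Qed.

Definition linf_pairing r (b : linf r) : ell1_dual r :=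
  exist (fun phi => phi \in @dual_pred _ (ell1 r)) _ (pairing_ell1_dual b).

Lemma linf_pairing_linear r : linear (@linf_pairing r).
Proof.
move=> c b b'; apply: dual_eq => a; apply: (pairing_linearl S_inv);
  [exact: linf_carrier_lty|exact: linf_carrier_lty|exact: ell1_carrier_lty].
Qed.

Definition linf_functional r : {linear linf r -> ell1_dual r} :=
  linear_of (@linf_pairing_linear r).

Lemma linf_functional_continuous r : continuous (@linf_functional r).
Proof.
apply: lcspace_continuous => -[]; exists tt => b /=.
apply: sup_on_le; first by rewrite fine_ge0 ?linf_norm_ge0.
move=> a /= a1.
apply: le_trans (pairing_le S_inv (linf_carrier_lty b) (ell1_carrier_lty a)) _.
by rewrite -[leRHS]mulr1 ler_wpM2l ?fine_ge0 ?linf_norm_ge0.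
Qed.

Lemma linf_union_lift (b : linf_union) : exists (r : {nonneg R}) (b' : linf r%:num),
  linf_to_union b' = b.
Proof.
have /asboolP[r r0 rb] := valP b.
have rbP : val b \in linf_pred S sigma (NngNum r0)%:num by apply/asboolP.
exists (NngNum r0), (exist (fun b => b \in linf_pred S sigma r) _ rbP).
exact: val_inj.
Qed.

Lemma pairing_alg_dual (b : linf_union) :
  (fun a : alg => pairing (val b) (val a)) \in @dual_pred _ alg.
Proof.
have [r [b' <-]] := linf_union_lift b.
(* The functional is the restriction of one on [ell1 r], whose continuity is known. *)
have := valP (ell1_dual_to_alg_dual (linf_functional _ b')).
by [].
Qed.

Definition union_pairing (b : linf_union) : alg_dual :=
  exist (fun phi => phi \in @dual_pred _ alg) _ (pairing_alg_dual b).

Lemma union_pairing_linear : linear union_pairing.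
Proof.
move=> c b b'; apply: dual_eq => a.
have /asboolP[r r0 rb] := valP b; have /asboolP[s s0 sb] := valP b'.
have rs0 : 0 <= Num.max r s by rewrite le_max r0.
apply: (pairing_linearl (r := Num.max r s) S_inv).
- by apply: le_lt_trans rb; apply: linf_norm_le; rewrite le_max lexx.
- by apply: le_lt_trans sb; apply: linf_norm_le; rewrite le_max lexx orbT.
- exact: (alg_carrier_lty (NngNum rs0)).
Qed.

Definition union_functional : {linear linf_union -> alg_dual} :=
  linear_of union_pairing_linear.

Lemma union_functionalE (r : {nonneg R}) (b : linf r%:num) :
  union_functional (linf_to_union b) = ell1_dual_to_alg_dual (linf_functional _ b).
Proof. exact: dual_eq. Qed.

Lemma union_functional_tr (b : linf_union) (a : alg) :
  tr_is (val b) (val a) (dual_fun (union_functional b) a).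
Proof.
have /asboolP[r r0 rb] := valP b.
exact: pairing_tr rb (alg_carrier_lty (NngNum r0) a).
Qed.

Lemma union_functional_delta (b : linf_union) g :
  dual_fun (union_functional b) (alg_delta (g^-1)%g) = val b g.
Proof. exact: pairing_delta. Qed.

Lemma union_functional_inj : injective union_functional.
Proof.
move=> b b' e; apply/val_inj/funext => g.
by rewrite -!union_functional_delta e.
Qed.

(** The coefficients are the values at unit vectors of inverses. One norm bounds [phi], and its
    value at a unit vector is a weight, so the coefficients lie in the union. *)
Lemma union_functional_surj (phi : alg_dual) : exists b, union_functional b = phi.
Proof.
have [r [C rC]] := alg_dual_bound phi.
pose b : G -> R[i]^o := fun g => dual_fun phi (alg_delta (g^-1)%g).
have bP : b \in linf_union_pred S sigma.
  apply/asboolP; exists r%:num => //; apply: (le_lt_trans _ (ltry C)).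
  apply: linf_norm_le_coef => g; apply: le_trans (rC _) _.
  by rewrite ell1_norm_delta /= weight_inv.
exists (exist (fun b => b \in linf_union_pred S sigma) _ bP).
apply: alg_dual_eq => g; rewrite -[g]invgK union_functional_delta /= /b.
by rewrite invgK.
Qed.

Lemma union_functional_bij : bijective union_functional.
Proof.
have [h hK] := boolp.choice union_functional_surj.
exists h => // b; apply: union_functional_inj; exact: hK.
Qed.

(** On a bounded set the norm of exponent [r] is bounded, so the supremum of a functional there is
    at most a multiple of its dual norm. *)
Lemma ell1_dual_to_alg_dual_continuous (r : {nonneg R}) :
  continuous (@ell1_dual_to_alg_dual R G S sigma r).
Proof.
apply: lcspace_continuous_bound => -[B Bb]; exists tt.
have [M BM] := tvs_bounded_seminorm r Bb.
(* The absolute value covers an empty [B], for which [M] may be negative. *)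
exists `|M| => phi /=.
have phi0 : 0 <= dual_norm (ell1_seminorm S sigma r%:num) phi by exact: sn_ge0.
apply: sup_on_le => [|a Ba]; first exact: mulr_ge0.
apply: le_trans (dual_norm_ge phi (alg_to_ell1 r a)) _.
rewrite mulrC ler_wpM2r//; apply: le_trans (ler_norm M); exact: BM.
Qed.

Lemma union_functional_continuous (r : {nonneg R}) :
  continuous (union_functional \o @linf_to_union r).
Proof.
rewrite (_ : _ \o _ = @ell1_dual_to_alg_dual R G S sigma r \o @linf_functional r%:num).
  move=> b; apply: continuous_comp; first exact: linf_functional_continuous.
  exact: ell1_dual_to_alg_dual_continuous.
by apply/funext => b; exact: union_functionalE.
Qed.

(** Integer exponents give powers of [weight 1], which plays the role of [t] in
    [diagonal_weight]. *)
Lemma weight_natE n g : weight n%:R g = weight 1 g ^+ n.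
Proof.
have s0 := le_trans ler01 (gf_ge1 sigma (word_length S g)).
by rewrite /Defs.weight powRr1// powR_mulrn.
Qed.

Lemma alg_dual_finest (F : tvsType R[i]) (f : {linear alg_dual -> F}) :
  (forall r : {nonneg R}, continuous (f \o (union_functional \o @linf_to_union r))) ->
  continuous f.
Proof.
move=> fc; apply: linear_continuous0 => U U0.
have [B Bconv [Bopen Bbasis]] := @locally_convex R[i] F.
have [b [Bb b0] bU] := Bbasis 0 U U0.
have nb0 : nbhs 0 b by apply: open_nbhs_nbhs; split => //; exact: Bopen.
have bmid := convex_midpoint (Bconv b (mem_set Bb)).
(* The convex neighbourhood [b] is pulled back to coefficient functions, the setting of
   [diagonal_weight]. *)
pose V := [set val c | c in [set c : linf_union | b (f (union_functional c))]].
have epsP n : exists e : R, 0 < e /\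
    forall c : G -> R[i]^o, (forall g, normc (c g) <= e * weight 1 g ^+ n) -> V c.
  have n0 : 0 <= n%:R :> R by [].
  have fu0 : f (union_functional (linf_to_union (0 : linf (NngNum n0)%:num))) = 0.
    by rewrite !linear0.
  have [s [e [e0 sb]]] : nbhs (0 : linf (NngNum n0)%:num)
      ((f \o (union_functional \o @linf_to_union (NngNum n0))) @^-1` b).
    by apply: fc; rewrite -[X in nbhs X]fu0 in nb0.
  (* Halving turns the non-strict coefficient bounds into membership in the open ball of radius
     [e]. *)
  exists (e / 2); split; first by rewrite divr_gt0.
  move=> c ce.
  have cn : (linf_norm n%:R c <= (e / 2)%:E)%E.
    by apply: linf_norm_le_coef => g; rewrite weight_natE.
  have cP : c \in linf_pred S sigma (NngNum n0)%:num.
    by apply/asboolP; exact: le_lt_trans cn (ltry _).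
  pose c' : linf (NngNum n0)%:num := exist (fun b => b \in linf_pred S sigma n%:R) _ cP.
  exists (linf_to_union c') => //=; apply: sb.
  rewrite /sn_ball/=; apply/allP => _ _; rewrite subr0 /= /fine_linf_norm.
  rewrite -lte_fin fineK ?linf_norm_fin ?linf_carrier_lty//.
  by apply: le_lt_trans cn _; rewrite lte_fin ltr_pdivrMr// ltr_pMr// ltr1n.
have {epsP}[eps epsP] := boolp.choice epsP.
have Vmid c d : V c -> V d -> V (fun g => 2^-1 * (c g + d g)).
  move=> [c' bc' <-] [d' bd' <-]; exists (2^-1 *: (c' + d')); last by [].
  by rewrite /mkset linearZ_LR linearD linearZ_LR linearD; exact: bmid.
have w1 g : 1 <= weight 1 g by rewrite -[leLHS](powRr0 (sigma (word_length S g))) weight_le.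
have [v [v0 vw vV]] := diagonal_weight w1 (fun n => (epsP n).1)
  (fun n => (epsP n).2) Vmid.
(* The functional with coefficients [c] takes the values [c g / v g] on [X], so the polar of [X] is
   given by [normc (c g) <= v g]. *)
pose X : set alg := [set (v g)^-1%:C%C *: alg_delta (g^-1)%g | g in [set: G]].
have Xb : tvs_bounded X.
  apply: lcspace_bounded => r.
  (* A real exponent is rounded up to reach the integer powers that [v] dominates. *)
  pose n := (Num.trunc r%:num).+1; have [M vM] := vw n.
  exists M => _ [g _ <-]; rewrite snZ alg_seminorm_delta (weight_inv sigma S_inv).
  rewrite normc_real gtr0_norm ?invr_gt0// mulrC ler_pdivrMr//.
  apply: le_trans (vM g); rewrite -weight_natE; apply: weight_le.
  by rewrite ltW// truncnS_gt.
have := @lcspace_nbhs0_lt R (dual alg) _ (@strong_seminorm R alg) (exist _ X Xb) 1 ltr01.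
apply: filterS => phi /= Xphi.
have [c cphi] := union_functional_surj phi.
have [r [b' b'c]] := linf_union_lift c.
(* Polynomial growth comes from a space [linf r] that contains [c], the bound by [v] from [Xphi]. *)
have : V (val c).
  apply: (vV (Num.trunc r%:num).+1 (fine (linf_norm r%:num (val c)))) => g.
    have rc : (linf_norm r%:num (val c) < +oo)%E by rewrite -b'c; exact: linf_carrier_lty.
    apply: le_trans (linf_coef_le g rc) _.
    rewrite ler_wpM2l ?fine_ge0 ?linf_norm_ge0// -weight_natE weight_le//.
    by rewrite ltW// truncnS_gt.
  have Xg : X ((v g)^-1%:C%C *: alg_delta (g^-1)%g) by exists g.
  have := le_lt_trans (sup_on_ge (tvs_bounded_dual Xb) phi Xg) Xphi.
  have -> : dual_fun phi ((v g)^-1%:C%C *: alg_delta (g^-1)%g) =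
      (v g)^-1%:C%C * val c g :> R[i].
    by rewrite -(union_functional_delta c) cphi linearZ_LR.
  rewrite normcM normc_real gtr0_norm ?invr_gt0// mulrC ltr_pdivrMr// mul1r.
  exact: ltW.
move=> [c' bc' /val_inj c'c]; apply: bU.
by rewrite -cphi -c'c; exact: bc'.
Qed.

End dual_of_alg.

(** * The two inductive limit presentations of the strong dual *)

Theorem theorem7p7 (R : realType) (G : groupType) (S : {fset G})
    (sigma : growth_function R) :
  infinite_set [set: G] ->
  (forall x, x \in S -> (x^-1)%g \in S) ->
  generates S ->
  almost_submultiplicative sigma ->
  growth_le (fun n => (volume_growth S n)%:R) sigma ->
  is_lc_inductive_limit (X := ell1_dual_system S sigma) (E := alg_dual S sigma)
    (fun r => @ell1_dual_to_alg_dual R G S sigma r) /\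
  exists Phi : {linear linf_union S sigma -> alg_dual S sigma},
    [/\ bijective Phi,
        forall (b : linf_union S sigma) (a : alg S sigma),
          tr_is (val b) (val a) (dual_fun (Phi b) a)
      & is_lc_inductive_limit (X := linf_system S sigma) (E := alg_dual S sigma)
          (fun r => Phi \o @linf_to_union R G S sigma r)].
Proof.
move=> _ S_inv _ _ _; split.
  split.
  - move=> i j ij x; apply: dual_eq => a; congr (dual_fun x _); exact/val_inj.
  - move=> phi; have [b <-] := union_functional_surj S_inv phi.
    have [r [b' <-]] := linf_union_lift b.
    exists r, (linf_functional sigma S_inv r%:num b'); exact/esym/union_functionalE.
  (* Restriction to [alg] is injective on each step, so [j] can be [i]. *)
  - move=> i x x0; exists i, (lexx i).
    rewrite transition_id; apply: ell1_dual_eq => g.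
    have -> : ell1_delta S sigma i%:num g = alg_to_ell1 i (alg_delta S sigma g).
      exact/val_inj.
    exact: (congr1 (fun phi : alg_dual S sigma => dual_fun phi _) x0).
  - by move=> r; exact: ell1_dual_to_alg_dual_continuous.
  (* Precomposition with the continuous maps [linf_functional] turns continuity on the duals into
     continuity on the spaces [linf r]. *)
  - move=> F f _ fc; apply: (alg_dual_finest (S_inv := S_inv)) => r.
    have E : f \o (union_functional sigma S_inv \o @linf_to_union R G S sigma r) =
        (f \o @ell1_dual_to_alg_dual R G S sigma r) \o linf_functional sigma S_inv r%:num.
      by apply/funext => b; congr (f _); exact: union_functionalE.
    rewrite E => b; apply: continuous_comp; last exact: fc.
    exact: linf_functional_continuous.
exists (union_functional sigma S_inv); split.
- exact: union_functional_bij.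
- exact: union_functional_tr.
split.
- move=> i j ij x; congr (union_functional sigma S_inv _); exact/val_inj.
- move=> phi; have [b <-] := union_functional_surj S_inv phi.
  by have [r [b' <-]] := linf_union_lift b; exists r, b'.
(* Again [j = i]: the inclusion into the union and [union_functional] are both injective. *)
- move=> i x x0; exists i, (lexx i); rewrite transition_id.
  have /(congr1 val) vx : linf_to_union x = 0.
    by apply: (union_functional_inj (S_inv := S_inv)); rewrite linear0.
  exact/val_inj.
- exact: union_functional_continuous.
- move=> F f _; exact: alg_dual_finest.
Qed.
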